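(* There is an algorithm that, given a finite set $D\subseteq\mathbb{Z}^2$ and non-negative integers $b,a$ such that the polynomial $g=f_D-(b-a)\in\mathbb{Z}[x^{\pm1},y^{\pm1}]$ has line polynomial factors in at most one primitive direction, determines whether there exists a $(D,b,a)$-covering.
   Context: Write $X^{\vec u}=x^{u_1}y^{u_2}$ and $f_D=\sum_{\vec u\in D}X^{-\vec u}$. A line polynomial is a Laurent polynomial in $\mathbb{C}[x^{\pm1},y^{\pm1}]$ whose support has at least two points, all on a line $\vec u+\mathbb{Q}\vec v$; it is then in direction $\vec v$. Parallel directions are identified. Having line polynomial factors in at most one primitive direction means all line polynomial divisors of $g$ are in directions parallel to a single vector. A $(D,b,a)$-covering is a configuration $c\in\{0,1\}^{\mathbb{Z}^2}$ such that for every $\vec u$, the number of $\vec v\in\vec u+D$ with $c_{\vec v}=1$ equals $a$ if $c_{\vec u}=0$ and $b$ if $c_{\vec u}=1$. *)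

(* Defs.v *)
From HB Require Import structures.
From mathcomp Require Import all_boot all_order all_algebra finmap.
From mathcomp Require Import complex reals.
From mathcomp Require Export monalg.

Set Implicit Arguments.
Unset Strict Implicit.
Unset Printing Implicit Defensive.

Import GRing.Theory.

Local Open Scope fset_scope.
Local Open Scope ring_scope.
Local Open Scope complex_scope.

(* CC is [R[i]] for an arbitrary [R : realType].
   [{malg K[int * int]}] is the additive group of finitely supported functions
   from [int * int] to [K].  Its library product requires the exponent monoid
   to have no invertible element other than the neutral one, which excludes
   [int * int]; hence [lmul]. *)
Notation laurent R := {malg R[i][(int * int)%type]}.

Definition lmul (R : realType) (f g : laurent R) : laurent R :=
  \sum_(u <- msupp f) \sum_(v <- msupp g) << f@_u * g@_v *g u + v >>.

Definition ldvd (R : realType) (f g : laurent R) : Prop :=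
  exists h : laurent R, g = lmul f h.

(* w belongs to u + QQ v *)
Definition on_line (u v w : int * int) : Prop :=
  exists q : rat, (w.1 - u.1)%:~R = q * v.1%:~R
               /\ (w.2 - u.2)%:~R = q * v.2%:~R.

Definition line_poly_in_direction (R : realType) (v : int * int)
    (f : laurent R) : Prop :=
  [/\ v != 0, (1 < #|` msupp f|)%N
    & exists u, forall w, w \in msupp f -> on_line u v w].

Definition parallel (v w : int * int) : Prop := on_line 0 v w.

Definition line_factors_in_at_most_one_direction (R : realType)
    (g : laurent R) : Prop :=
  exists2 v : int * int, v != 0 &
    forall (f : laurent R) (w : int * int),
      line_poly_in_direction w f -> ldvd f g -> parallel v w.

Definition fpoly (R : realType) (D : {fset int * int}) : laurent R :=
  \sum_(u <- D) << - u >>.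

Definition covering_poly (R : realType) (D : {fset int * int})
    (b a : nat) : laurent R :=
  fpoly R D - << (b%:Z - a%:Z)%:~R *g 0 >>.

Definition covering (D : {fset int * int}) (b a : nat)
    (c : int * int -> bool) : Prop :=
  forall u : int * int,
    #|` [fset v in [fset u + d | d in D] | c v]| = if c u then b else a.

(* Kleene's partial recursive functions, as codes without a declared arity,
   acting on argument lists; [eval p xs y] means that p halts on xs with
   output y. *)
Inductive recfun : Type :=
| Zero
| Succ
| Proj of nat
| Comp of recfun & seq recfun
| PrimRec of recfun & recfun
| Mu of recfun.

Inductive eval : recfun -> seq nat -> nat -> Prop :=
| EvalZero xs : eval Zero xs 0
| EvalSucc x : eval Succ [:: x] x.+1
| EvalProj i xs : (i < size xs)%N -> eval (Proj i) xs (nth 0%N xs i)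
| EvalComp f gs xs ys y :
    size ys = size gs ->
    (forall i, (i < size gs)%N -> eval (nth Zero gs i) xs (nth 0%N ys i)) ->
    eval f ys y -> eval (Comp f gs) xs y
| EvalPrimRec0 f g xs y : eval f xs y -> eval (PrimRec f g) (0%N :: xs) y
| EvalPrimRecS f g n xs r y :
    eval (PrimRec f g) (n :: xs) r -> eval g [:: n, r & xs] y ->
    eval (PrimRec f g) (n.+1 :: xs) y
| EvalMu f xs n (k : nat -> nat) :
    (forall m, (m < n)%N -> eval f (m :: xs) (k m).+1) ->
    eval f (n :: xs) 0 -> eval (Mu f) xs n.

Lemma eval_det p xs y : eval p xs y -> forall z, eval p xs z -> y = z.
Proof.
elim=> {p xs y}.
- by move=> xs z H; inversion H.
- by move=> x z H; inversion H.
- by move=> i xs _ z H; inversion H.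
- move=> f gs xs ys y sz _ IHg _ IHf z H; inversion H; subst.
  apply: IHf; suff -> : ys = ys0 by [].
  by apply: (@eq_from_nth _ 0%N) => [|i]; rewrite sz // => lti; apply: IHg; auto.
- by move=> f g xs y _ IH z H; inversion H; subst; apply: IH.
- move=> f g n xs r y _ IHr _ IHg z H.
  inversion H as [| | | | |? ? ? ? r' ? Er Eg|]; subst.
  by apply: IHg; rewrite (IHr _ Er).
- move=> f xs n k _ IHk _ IH0 z H.
  inversion H as [| | | | | |? ? ? k' Ek' E0]; subst.
  case: (ltngtP n z) => // lt; first by have := IH0 _ (Ek' _ lt).
  by have := IHk _ lt _ E0.
Qed.

(* 0, -1, 1, -2, 2, ... are coded by 0, 1, 2, 3, 4, ... *)
Definition code_int (z : int) : nat :=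
  match z with Posz n => n.*2 | Negz n => n.*2.+1 end.

Definition code_point (u : int * int) : nat :=
  CodeSeq.code [:: code_int u.1; code_int u.2].

Definition code_points (s : seq (int * int)) : nat :=
  CodeSeq.code (map code_point s).

(* Main.v *)
(* If [c] is a covering and [v] spans the only admissible direction of line
   factors, then [e = X^v c - c] is a bounded integer configuration annihilated by
   [g].  As [g(X)^p = g(X^p)] modulo a prime [p], boundedness makes [g(X^n)]
   annihilate [e] for all [n = 1 mod q]; eliminating all but one term of [g] from
   these relations shows that a product of binomials [X^w - 1] annihilates [e].
   Let [w = m w0] be nonparallel to [v], with [w0] primitive, and let [d] be
   annihilated by [g] and [X^w - 1].  Modulo [X^w0 - z], a factor of [X^w - 1]
   that cannot divide [g], the polynomial [g] becomes a nonzero polynomial in one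
   variable, so that [d] satisfies a linear recurrence in a second direction.
   Being bounded, it is doubly periodic, and [X^w - 1] may be replaced by some
   [X^(N v) - 1].  Hence [c] is itself periodic in direction [v], and by the
   pigeonhole principle there is also a doubly periodic covering.

   The algorithm therefore looks for the first [n > 0] for which either the
   [n]-by-[n] torus has a covering or some [n]-by-[n] window has no locally valid
   pattern; by compactness one of the two occurs. *)

Require Import Defs.
From mathcomp Require Import all_boot all_order all_algebra all_field finmap.
From mathcomp Require Import complex reals.
From mathcomp Require Import zify ring.
From mathcomp Require boolp filter.

Set Implicit Arguments.
Unset Strict Implicit.
Unset Printing Implicit Defensive.

Import Order.TTheory GRing.Theory Num.Theory.

(** * Closure properties of computable functions *)

Definition computable (n : nat) (f : seq nat -> nat) : Prop :=
  exists p, forall xs, size xs = n -> eval p xs (f xs).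

Lemma eq_computable n f g :
  (forall xs, size xs = n -> f xs = g xs) -> computable n f -> computable n g.
Proof. by move=> efg [p Hp]; exists p => xs sz; rewrite -efg //; apply: Hp. Qed.

Lemma computable_proj n i : i < n -> computable n (fun xs => nth 0 xs i).
Proof. by move=> lt; exists (Proj i) => xs sz; constructor; rewrite sz. Qed.

Lemma computable_codes n (fs : seq (seq nat -> nat)) :
  (forall i, i < size fs -> computable n (nth (fun=> 0) fs i)) ->
  exists ps, size ps = size fs /\
    forall xs, size xs = n -> forall i, i < size ps ->
      eval (nth Zero ps i) xs (nth 0 [seq f xs | f <- fs] i).
Proof.
elim: fs => [|f fs IH] H; first by exists [::].
have [p Hp] := H 0 isT.
have [ps [sz Hps]] := IH (fun i => H i.+1).
exists (p :: ps); split=> /=; first by rewrite sz.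
by move=> xs szx [|i] /= lti; [exact: Hp | exact: Hps].
Qed.

Lemma computable_comp n m (fs : seq (seq nat -> nat)) g :
  size fs = m -> computable m g ->
  (forall i, i < m -> computable n (nth (fun=> 0) fs i)) ->
  computable n (fun xs => g [seq f xs | f <- fs]).
Proof.
move=> <- [p Hp] /computable_codes[ps [sz Hps]].
exists (Comp p ps) => xs szx; apply: (EvalComp (ys := [seq f xs | f <- fs])).
- by rewrite size_map sz.
- exact: Hps.
- by apply: Hp; rewrite size_map.
Qed.

Lemma computable_comp1 n (h : nat -> nat) f :
  computable 1 (fun xs => h (nth 0 xs 0)) -> computable n f ->
  computable n (fun xs => h (f xs)).
Proof.
by move=> hh hf; apply: (computable_comp (fs := [:: f]) _ hh) => // -[].
Qed.

Lemma computable_comp2 n (h : nat -> nat -> nat) f g :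
  computable 2 (fun xs => h (nth 0 xs 0) (nth 0 xs 1)) ->
  computable n f -> computable n g -> computable n (fun xs => h (f xs) (g xs)).
Proof.
move=> hh hf hg; apply: (computable_comp (fs := [:: f; g]) _ hh) => //.
by move=> [|[]].
Qed.

Lemma computable_const n k : computable n (fun=> k).
Proof.
elim: k => [|k IH]; first by exists Zero => xs _; constructor.
apply: (computable_comp1 (h := succn) _ IH).
by exists Succ => -[|x []] //= _; constructor.
Qed.

Lemma computable_succ n f : computable n f -> computable n (fun xs => (f xs).+1).
Proof.
apply: computable_comp1.
by exists Succ => -[|x []] //= _; constructor.
Qed.

(** [PrimRec] recurses on the head of its argument list, so its code is composed with [b] followed
    by all the projections. *)
Lemma computable_rec n f g b :
  computable n f -> computable n.+2 g -> computable n b ->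
  computable n (fun xs => nat_rect _ (f xs) (fun k r => g [:: k, r & xs]) (b xs)).
Proof.
move=> [pf Hf] [pg Hg] Hb.
have Hr : computable n.+1 (fun xs =>
    nat_rect (fun=> nat) (f (behead xs)) (fun k r => g [:: k, r & behead xs])
      (head 0 xs)).
  exists (PrimRec pf pg) => -[//|k xs] /= [sz].
  elim: k => [|k IH] /=; first by constructor; apply: Hf.
  by apply: EvalPrimRecS IH _; apply: Hg; rewrite /= sz.
have := @computable_comp n n.+1
  (b :: [seq (fun xs => nth 0 xs i) | i <- iota 0 n]) _ _ Hr.
rewrite /= size_map size_iota => /(_ erefl) H.
apply: eq_computable (H _) => [xs sz|[|i] lti] //=.
  suff -> : [seq f0 xs | f0 <- [seq (nth 0)^~ i | i <- iota 0 n]] = xs by [].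
  by rewrite -map_comp -[RHS](@mkseq_nth _ 0) sz.
by rewrite (nth_map 0) ?size_iota // nth_iota //; apply: computable_proj.
Qed.

Lemma computable_iter n (h : nat -> nat) b x :
  computable 1 (fun xs => h (nth 0 xs 0)) -> computable n b -> computable n x ->
  computable n (fun xs => iter (b xs) h (x xs)).
Proof.
move=> hh Hb Hx.
have Hg : computable n.+2 (fun xs => h (nth 0 xs 1)).
  by apply: computable_comp1 hh _; apply: computable_proj.
apply: eq_computable (computable_rec Hx Hg Hb) => xs sz /=.
by elim: (b xs) => //= k ->.
Qed.

Lemma computable_add n f g : computable n f -> computable n g ->
  computable n (fun xs => f xs + g xs).
Proof.
move=> Hf Hg; apply: eq_computable (computable_iter (h := succn) _ Hf Hg).
  by move=> xs _; rewrite iter_succn addnC.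
by apply/computable_succ/computable_proj.
Qed.

Lemma computable_sum n (F : nat -> seq nat -> nat) b :
  computable n.+1 (fun xs => F (head 0 xs) (behead xs)) -> computable n b ->
  computable n (fun xs => \sum_(0 <= i < b xs) F i xs).
Proof.
move=> HF Hb.
(* The recursion step receives the counter, the accumulator and then [xs]; the summand has to skip
   the accumulator. *)
have HF2 : computable n.+2 (fun xs => F (nth 0 xs 0) (drop 2 xs)).
  have := @computable_comp n.+2 n.+1
    ((nth 0)^~ 0 :: [seq (fun xs => nth 0 xs i) | i <- iota 2 n]) _ _ HF.
  rewrite /= size_map size_iota => /(_ erefl) H.
  apply: eq_computable (H _) => [[|x [|y xs]] //= [sz]|[|i] lti] /=.
  - congr F; rewrite drop0 -map_comp -[RHS](@mkseq_nth _ 0) sz /mkseq.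
    by rewrite -[2]/(2 + 0) iotaDl -map_comp; apply: eq_map.
  - exact: computable_proj.
  - rewrite (nth_map 0) ?size_iota // nth_iota //; apply: computable_proj.
    by rewrite add2n.
have Hg : computable n.+2 (fun xs => nth 0 xs 1 + F (nth 0 xs 0) (drop 2 xs)).
  by apply: computable_add => //; apply: computable_proj.
apply: eq_computable (computable_rec (computable_const _ 0) Hg Hb) => xs sz /=.
by elim: (b xs) => [|k IH]; [rewrite big_geq | rewrite big_nat_recr //= -IH drop0 addnC].
Qed.

Lemma computable_mul n f g : computable n f -> computable n g ->
  computable n (fun xs => f xs * g xs).
Proof.
move=> Hf Hg.
have Hp : computable 2 (fun xs => nth 0 xs 0 * nth 0 xs 1).
  have H1 : computable 2 (fun xs => \sum_(0 <= i < nth 0 xs 0) nth 0 xs 1).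
    apply: (computable_sum (F := fun _ xs => nth 0 xs 1)).
      apply: eq_computable (computable_proj (isT : 2 < 3)).
      by move=> [|? []].
    exact: computable_proj.
  by apply: eq_computable H1 => xs _; rewrite sum_nat_const_nat subn0.
exact: (computable_comp2 (h := muln)).
Qed.

Lemma computable_pred n f : computable n f -> computable n (fun xs => (f xs).-1).
Proof.
apply: computable_comp1.
have := computable_rec (computable_const 1 0) (computable_proj (isT : 0 < 3))
  (computable_proj (isT : 0 < 1)).
by apply: eq_computable => -[|[|k] []].
Qed.

Lemma computable_sub n f g : computable n f -> computable n g ->
  computable n (fun xs => f xs - g xs).
Proof.
move=> Hf Hg; apply: eq_computable (computable_iter (h := predn) _ Hg Hf).
  by move=> xs _; elim: (g xs) => [|k /= ->]; rewrite ?subn0 // subnS.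
by apply/computable_pred/computable_proj.
Qed.

Lemma computable_leq n f g : computable n f -> computable n g ->
  computable n (fun xs => f xs <= g xs : nat).
Proof.
move=> Hf Hg.
apply: eq_computable (computable_sub (computable_const _ 1) (computable_sub Hf Hg)).
by move=> xs _; rewrite /leq; case: (f xs - g xs).
Qed.

Lemma computable_and n (P Q : seq nat -> bool) :
  computable n (fun xs => P xs : nat) -> computable n (fun xs => Q xs : nat) ->
  computable n (fun xs => P xs && Q xs : nat).
Proof.
move=> HP HQ; apply: eq_computable (computable_mul HP HQ) => xs _.
by rewrite mulnb.
Qed.

Lemma computable_not n (P : seq nat -> bool) :
  computable n (fun xs => P xs : nat) -> computable n (fun xs => ~~ P xs : nat).
Proof.
move=> HP; apply: eq_computable (computable_sub (computable_const _ 1) HP).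
by move=> xs _; case: (P xs).
Qed.

Lemma computable_eq n f g : computable n f -> computable n g ->
  computable n (fun xs => f xs == g xs : nat).
Proof.
move=> Hf Hg; apply: eq_computable (computable_and (computable_leq Hf Hg)
  (computable_leq Hg Hf)) => xs _.
by rewrite -eqn_leq.
Qed.

Lemma computable_if n (P : seq nat -> bool) f g :
  computable n (fun xs => P xs : nat) -> computable n f -> computable n g ->
  computable n (fun xs => if P xs then f xs else g xs).
Proof.
move=> HP Hf Hg; apply: eq_computable (computable_add (computable_mul HP Hf)
  (computable_mul (computable_not HP) Hg)) => xs _.
by case: (P xs); rewrite /= mul1n ?addn0.
Qed.

(** Quotients and 2-adic valuations are obtained by counting the indices that satisfy a downward
    closed condition. *)
Lemma sum_ord_ltn n m : m <= n -> \sum_(i < n) (i < m : nat) = m.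
Proof.
move=> le; rewrite -[RHS]card_ord -sum1_card.
by rewrite (big_ord_widen n (fun=> 1) le) [RHS]big_mkcond.
Qed.

Lemma computable_div n f g : computable n f -> computable n g ->
  computable n (fun xs => f xs %/ g xs).
Proof.
move=> Hf Hg; apply: (computable_comp2 (h := divn)) Hf Hg.
(* The quotient counts the positive multiples of the divisor up to the dividend; the second conjunct
   gives 0 for the divisor 0. *)
have H : computable 2 (fun xs => \sum_(0 <= i < nth 0 xs 0)
     ((i.+1 * nth 0 xs 1 <= nth 0 xs 0) && (1 <= nth 0 xs 1) : nat)).
  apply: (computable_sum (F := fun i xs =>
    ((i.+1 * nth 0 xs 1 <= nth 0 xs 0) && (1 <= nth 0 xs 1) : nat))); last first.
    exact: computable_proj.
  apply: (@eq_computable _ (fun xs =>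
    ((nth 0 xs 0).+1 * nth 0 xs 2 <= nth 0 xs 1) && (1 <= nth 0 xs 2) : nat)).
    by case.
  apply: computable_and; apply: computable_leq; try exact: computable_const;
    try exact: computable_proj.
  by apply: computable_mul; [apply: computable_succ|]; apply: computable_proj.
apply: eq_computable H => xs _; rewrite big_mkord; set a := nth 0 xs 0; case: (nth 0 xs 1) => [|d].
  by rewrite divn0 big1 // => i _; rewrite andbF.
under eq_bigr => i _ do rewrite andbT -leq_divRL //.
by rewrite sum_ord_ltn // leq_div.
Qed.

Lemma computable_mod n f g : computable n f -> computable n g ->
  computable n (fun xs => f xs %% g xs).
Proof.
move=> Hf Hg; apply: eq_computable (computable_sub Hf
  (computable_mul (computable_div Hf Hg) Hg)) => xs _.
by rewrite {1}(divn_eq (f xs) (g xs)) addKn.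
Qed.

Lemma computable_exp2 n f : computable n f -> computable n (fun xs => 2 ^ f xs).
Proof.
apply: (computable_comp1 (h := fun k => 2 ^ k)).
apply: (@eq_computable _ (fun xs => iter (nth 0 xs 0) (muln 2) 1)).
  by move=> xs _; elim: (nth 0 xs 0) => //= k ->; rewrite expnS.
apply: computable_iter; try exact: computable_proj; try exact: computable_const.
by apply: computable_mul; [exact: computable_const|exact: computable_proj].
Qed.

Lemma computable_odd n f : computable n f ->
  computable n (fun xs => odd (f xs) : nat).
Proof.
move=> Hf; apply: eq_computable (computable_mod Hf (computable_const _ 2)).
by move=> xs _; rewrite modn2.
Qed.

Lemma computable_log2 n f : computable n f ->
  computable n (fun xs => logn 2 (f xs)).
Proof.
apply: (computable_comp1 (h := logn 2)).
(* The valuation [v] of [x > 0] counts the [i] with [2 ^ i.+1] dividing [x]; the range [i < x]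
   suffices since [2 ^ v <= x] forces [v < x]. *)
have H : computable 1 (fun xs =>
    \sum_(0 <= i < nth 0 xs 0) (nth 0 xs 0 %% 2 ^ i.+1 == 0 : nat)).
  apply: (computable_sum (F := fun i xs => (nth 0 xs 0 %% 2 ^ i.+1 == 0 : nat)));
    last exact: computable_proj.
  apply: (@eq_computable _ (fun xs =>
    (nth 0 xs 1 %% 2 ^ (nth 0 xs 0).+1 == 0) : nat)); first by case.
  apply: computable_eq; last exact: computable_const.
  apply: computable_mod; first exact: computable_proj.
  by apply/computable_exp2/computable_succ/computable_proj.
apply: eq_computable H => xs _; case: (nth 0 xs 0) => [|x]; first by rewrite big_geq.
rewrite big_mkord.
under eq_bigr => i _ do rewrite -/(dvdn _ _) pfactor_dvdn //.
rewrite sum_ord_ltn //; apply/ltnW/(leq_trans (ltn_expl _ (isT : 1 < 2))).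
by apply: dvdn_leq => //; apply: pfactor_dvdnn.
Qed.

Lemma computable_head n : computable n.+1 (head 0).
Proof.
by apply: eq_computable (computable_proj (isT : 0 < n.+1)) => xs _; rewrite nth0.
Qed.

(** [computable_sum] presents its summand through [head] and [behead]; this lemma and the next turn
    such goals back into projections. *)
Lemma computable_nth_behead n (l : seq nat -> seq nat) i :
  computable n (fun xs => nth 0 (l xs) i.+1) ->
  computable n (fun xs => nth 0 (behead (l xs)) i).
Proof. by apply: eq_computable => xs _; rewrite nth_behead. Qed.

Lemma computable_head_nth n (l : seq nat -> seq nat) :
  computable n (fun xs => nth 0 (l xs) 0) -> computable n (fun xs => head 0 (l xs)).
Proof. by apply: eq_computable => xs _; rewrite nth0. Qed.

Ltac computable_step :=
  match goal with
  | |- computable _ (fun _ => ?c) => exact: computable_const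
  | |- computable _ (fun xs => nth 0 xs _) => exact: computable_proj
  | |- computable _ (fun xs => head 0 xs) => exact: computable_head
  | |- computable _ (head 0) => exact: computable_head
  | |- computable _ (fun xs => nth 0 (behead _) _) => apply: computable_nth_behead
  | |- computable _ (fun xs => head 0 _) => apply: computable_head_nth
  | |- computable _ (fun xs => (_ + _)) => apply: computable_add
  | |- computable _ (fun xs => (_ - _)) => apply: computable_sub
  | |- computable _ (fun xs => (_ * _)) => apply: computable_mul
  | |- computable _ (fun xs => (_ %/ _)) => apply: computable_div
  | |- computable _ (fun xs => (_ %% _)) => apply: computable_mod
  | |- computable _ (fun xs => _.+1) => apply: computable_succ
  | |- computable _ (fun xs => _.-1) => apply: computable_pred
  | |- computable _ (fun xs => 2 ^ _) => apply: computable_exp2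
  | |- computable _ (fun xs => logn 2 _) => apply: computable_log2
  | |- computable _ (fun xs => nat_of_bool (odd _)) => apply: computable_odd
  | |- computable _ (fun xs => nat_of_bool (_ <= _)) => apply: computable_leq
  | |- computable _ (fun xs => nat_of_bool (_ == _)) => apply: computable_eq
  | |- computable _ (fun xs => nat_of_bool (_ && _)) => apply: computable_and
  | |- computable _ (fun xs => nat_of_bool (~~ _)) => apply: computable_not
  | |- computable _ (fun xs => if _ then _ else _) => apply: computable_if
  | |- computable _ (fun xs => \sum_(0 <= i < _) _) => apply: computable_sum
  | |- computable _ (fun xs => iter _ _ _) => apply: computable_iter
  end.

(** * The search as an arithmetic program *)

(* The bits of [w < 2 ^ (n * n)] list a configuration of the [n]-by-[n] torus row by
   row, and [x] codes the points of [D].  The covering condition is tested only at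
   distance at least [M] from the border: [M = 0] tests the whole torus, while for
   [M = x], which bounds the coordinates of the points of [D], the sums never wrap
   around and the test concerns a plain window. *)
Definition bit (w k : nat) : bool := odd (w %/ 2 ^ k).

(** A nonempty list [k :: l] has code [2 ^ k * (CodeSeq.code l).*2.+1], so [logn 2] reads its head
    and this map returns the code of its tail. *)
Definition drop_code (x : nat) : nat := x %/ 2 ^ logn 2 x %/ 2.

(* The residue modulo [n] of the integer with [code_int] equal to [e]. *)
Definition residue (n e : nat) : nat :=
  if odd e then n.-1 - (e %/ 2) %% n else (e %/ 2) %% n.

(** A code is at least the length of its list, so [x] rounds visit every point; an exhausted list
    has code 0 and contributes nothing. *)
Definition hits (w n x i j : nat) : nat :=
  \sum_(0 <= k < x)
    if iter k drop_code x == 0 then 0 else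
    bit w ((i + residue n (logn 2 (logn 2 (iter k drop_code x)))) %% n * n +
           (j + residue n (logn 2 (drop_code (logn 2 (iter k drop_code x))))) %% n).

Definition violated (w M n x b a i j : nat) : bool :=
  [&& M <= i, i + M < n, M <= j, j + M < n &
     hits w n x i j != if bit w (i * n + j) then b else a].

Definition solutions (M n x b a : nat) : nat :=
  \sum_(0 <= w < 2 ^ (n * n))
    (\sum_(0 <= i < n) \sum_(0 <= j < n) violated w M n x b a i j == 0).

Lemma computable_solutions n fM fn fx fb fa :
  computable n fM -> computable n fn -> computable n fx -> computable n fb ->
  computable n fa ->
  computable n (fun xs => solutions (fM xs) (fn xs) (fx xs) (fb xs) (fa xs)).
Proof.
move=> HM Hn Hx Hb Ha.
have H : computable 5 (fun xs => solutions (nth 0 xs 0) (nth 0 xs 1) (nth 0 xs 2)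
    (nth 0 xs 3) (nth 0 xs 4)).
  rewrite /solutions /violated /hits /bit /residue /drop_code.
  by repeat computable_step.
apply: (computable_comp (fs := [:: fM; fn; fx; fb; fa]) _ H) => //.
by do 5?[case=> //].
Qed.

Definition periodic_found (n x b a : nat) : bool :=
  (0 < n) && (0 < solutions 0 n x b a).

Definition decided (n x b a : nat) : bool :=
  periodic_found n x b a || ((0 < n) && (solutions x n x b a == 0)).

Lemma decision_program : exists p, forall x b a,
  (exists n, decided n x b a) ->
  exists n, [/\ decided n x b a, forall m, m < n -> ~~ decided m x b a
     & eval p [:: x; b; a] (periodic_found n x b a)].
Proof.
have Hf n fn fx fb fa : computable n fn -> computable n fx -> computable n fb ->
    computable n fa ->
    computable n (fun xs => periodic_found (fn xs) (fx xs) (fb xs) (fa xs)).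
  move=> ? ? ? ?; apply: computable_and; apply: computable_leq => //;
    try exact: computable_const.
  by apply: computable_solutions => //; apply: computable_const.
have [p Hp] : computable 4 (fun xs =>
    ~~ decided (nth 0 xs 0) (nth 0 xs 1) (nth 0 xs 2) (nth 0 xs 3)).
  apply: computable_not; rewrite /decided.
  apply: (@eq_computable _ (fun xs => ~~ (
      ~~ periodic_found (nth 0 xs 0) (nth 0 xs 1) (nth 0 xs 2) (nth 0 xs 3) &&
      ~~ ((0 < nth 0 xs 0) && (solutions (nth 0 xs 1) (nth 0 xs 0) (nth 0 xs 1)
                             (nth 0 xs 2) (nth 0 xs 3) == 0))))).
    by move=> xs _; rewrite negb_and !negbK.
  apply/computable_not/computable_and; apply: computable_not.
    by apply: Hf; apply: computable_proj.
  apply: computable_and; first by do ! computable_step.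
  apply: computable_eq; last exact: computable_const.
  by apply: computable_solutions; apply: computable_proj.
have [q Hq] : computable 4 (fun xs =>
    periodic_found (nth 0 xs 0) (nth 0 xs 1) (nth 0 xs 2) (nth 0 xs 3)).
  by apply: Hf; apply: computable_proj.
exists (Comp q [:: Mu p; Proj 0; Proj 1; Proj 2]) => x b a exn.
exists (ex_minn exn); case: ex_minnP => n dn min_n.
have nd m : m < n -> ~~ decided m x b a.
  by move=> ltmn; apply: contraL ltmn => /min_n; rewrite -leqNgt.
split=> //; apply: (EvalComp (ys := [:: n; x; b; a])) => //; last first.
  exact: (Hq [:: n; x; b; a]).
case=> [|[|[|[|//]]]] _ /=; try by constructor.
(* The code [p] computes the negation of [decided]: it returns 1 below [n], the successor of the
   value of [k], and 0 at [n]. *)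
apply: (EvalMu (k := fun=> 0)) => [m ltmn|].
  by have := Hp [:: m; x; b; a] erefl; rewrite /= nd.
by have := Hp [:: n; x; b; a] erefl; rewrite /= dn.
Qed.

(** * Decoding points and configurations *)

Lemma logn_code k l : logn 2 (CodeSeq.code (k :: l)) = k.
Proof. by rewrite /= lognM ?expn_gt0 // pfactorK // lognE /= dvdn2 /= odd_double addn0. Qed.

Lemma drop_code_cons k l : drop_code (CodeSeq.code (k :: l)) = CodeSeq.code l.
Proof.
rewrite /drop_code logn_code /= mulKn ?expn_gt0 //.
by rewrite divn2 /= uphalf_double.
Qed.

Lemma drop_code0 k : iter k drop_code 0 = 0.
Proof. by elim: k => //= k ->. Qed.

Lemma code_cons_gt0 k l : 0 < CodeSeq.code (k :: l).
Proof. by rewrite /= muln_gt0 expn_gt0. Qed.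

Lemma size_code l : size l <= CodeSeq.code l.
Proof.
elim: l => //= k l IH; apply: (@leq_trans (CodeSeq.code l).*2.+1); last first.
  by rewrite leq_pmull // expn_gt0.
by rewrite ltnS (leq_trans IH) // -addnn leq_addr.
Qed.

Lemma sum_code (F : nat -> nat) l :
  \sum_(0 <= k < CodeSeq.code l)
    (if iter k drop_code (CodeSeq.code l) == 0 then 0
     else F (logn 2 (iter k drop_code (CodeSeq.code l))))
  = \sum_(y <- l) F y.
Proof.
(* The range of the sum is generalised to any [N] at least the length of [l], so that the induction
   can lower it by one per entry. *)
have := size_code l; move: {1 2}(CodeSeq.code l) => N.
elim: l N => [|y l IH] N leN.
  by rewrite big_nil big1 // => i _; rewrite drop_code0.
case: N leN => // N leN; rewrite big_nat_recl // big_cons /=.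
rewrite -[2 ^ y * _]/(CodeSeq.code (y :: l)) -(IH N) //; congr (_ + _).
  by rewrite eqn0Ngt code_cons_gt0 logn_code.
by apply: eq_bigr => i _; rewrite -iterS iterSr drop_code_cons.
Qed.

Local Open Scope fset_scope.
Local Open Scope ring_scope.

Lemma residueE (n : nat) (z : int) : (0 < n)%N ->
  (residue n (code_int z))%:Z = (z %% n)%Z.
Proof.
move=> n0; rewrite /residue; case: z => k; rewrite /code_int /= ?odd_double /=.
  by rewrite divn2 doubleK modz_nat.
rewrite divn2 /= uphalf_double modNz_nat //.
by have := ltn_pmod k n0; lia.
Qed.

(** The position, in the row-by-row bit list, of the torus point congruent to [z]. *)
Definition cell (n : nat) (z : int * int) : nat :=
  (`|(z.1 %% n)%Z| * n + `|(z.2 %% n)%Z|)%N.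

Lemma cell_mod n (i j : int) (d : int * int) : (0 < n)%N ->
  cell n (((i %% n)%Z, (j %% n)%Z) + d) = cell n ((i, j) + d).
Proof. by move=> n0; rewrite /cell /= !modzDml. Qed.

Lemma hitsE w (n : nat) s (i j : nat) : (0 < n)%N ->
  hits w n (code_points s) i j =
  (\sum_(d <- s) bit w (cell n ((i%:Z, j%:Z) + d)%R))%N.
Proof.
move=> n0; rewrite /hits /code_points.
rewrite (sum_code (fun y => nat_of_bool (bit w ((i + residue n (logn 2 y)) %% n * n +
           (j + residue n (logn 2 (drop_code y))) %% n)%N))) big_map.
apply: eq_bigr => d _; rewrite /code_point drop_code_cons !logn_code /cell /=.
rewrite -(modzDmr i) -(modzDmr j) -(residueE d.1 n0) -(residueE d.2 n0).
by rewrite -!PoszD !modz_nat !absz_nat.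
Qed.

Lemma solutions_gt0P M n s b a : (0 < n)%N ->
  (0 < solutions M n (code_points s) b a)%N <->
  exists2 w, (w < 2 ^ (n * n))%N & forall i j : nat,
    (M <= i)%N -> (i + M < n)%N -> (M <= j)%N -> (j + M < n)%N ->
    (\sum_(d <- s) bit w (cell n ((i%:Z, j%:Z) + d)%R))%N =
      if bit w (cell n (i%:Z, j%:Z)) then b else a.
Proof.
move=> n0.
have cell_nat i j : (i < n)%N -> (j < n)%N -> cell n (i%:Z, j%:Z) = (i * n + j)%N.
  by move=> lti ltj; rewrite /cell /= !modz_nat !absz_nat !modn_small.
rewrite /solutions lt0n big_mkord sum_nat_eq0 negb_forall; split.
  case/existsP => w; rewrite negb_imply eqb0 negbK => /andP[_].
  rewrite big_mkord sum_nat_eq0 => /forallP H; exists (w : nat) => //.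
  move=> i j Mi iM Mj jM.
  have lti : (i < n)%N by lia.
  have ltj : (j < n)%N by lia.
  have := H (Ordinal lti); rewrite big_mkord sum_nat_eq0 => /forallP /(_ (Ordinal ltj)).
  rewrite eqb0 /violated /= Mi iM Mj jM /= negbK hitsE // => /eqP ->.
  by rewrite cell_nat.
case=> w ltw H; apply/existsP; exists (Ordinal ltw).
rewrite negb_imply eqb0 negbK /=.
rewrite big_mkord sum_nat_eq0; apply/forallP => i.
rewrite big_mkord sum_nat_eq0; apply/forallP => j.
rewrite eqb0 /violated /= !negb_and negbK hitsE //.
case: (boolP (M <= i)%N) => //= Mi; case: (boolP (i + M < n)%N) => //= iM.
case: (boolP (M <= j)%N) => //= Mj; case: (boolP (j + M < n)%N) => //= jM.
by rewrite H // cell_nat.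
Qed.

(** Adding [2 ^ N] leaves the bits below [N] unchanged: for [k < N] it changes the quotient by
    [2 ^ k] by an even number. *)
Lemma bits_exist (f : nat -> bool) N :
  exists2 w, (w < 2 ^ N)%N & forall k, (k < N)%N -> bit w k = f k.
Proof.
elim: N => [|N [w ltw Hw]]; first by exists 0%N.
exists (w + f N * 2 ^ N)%N.
  by rewrite expnS; case: (f N); lia.
move=> k; rewrite ltnS leq_eqVlt /bit => /predU1P[->|ltk].
  by rewrite addnC divnMDl ?expn_gt0 // divn_small // addn0; case: (f N).
rewrite -(subnK (ltnW ltk)) expnD mulnA addnC divnMDl ?expn_gt0 // addnC.
rewrite oddD oddM oddX -/(bit w k) Hw //= orbF.
by rewrite subn_eq0 leqNgt ltk andbF addbF.
Qed.

(** Translation is injective, so the cardinality becomes a sum over any enumeration of [D], which is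
    the form that the program evaluates. *)
Lemma covering_sumE D b a (s : seq (int * int)) c : uniq s -> s =i D ->
  covering D b a c <->
  forall u, (\sum_(d <- s) c (u + d)%R)%N = if c u then b else a.
Proof.
move=> us sD.
suff E u : #|` [fset v in [fset u + d | d in D] | c v]| = (\sum_(d <- s) c (u + d)%R)%N.
  by split=> H u; [rewrite -E | rewrite E].
have -> : [fset v in [fset u + d | d in D] | c v] =
    [fset u + d | d in [seq d <- s | c (u + d)]].
  apply/fsetP => v; rewrite !inE /=.
  apply/andP/imfsetP => /= [[/imfsetP[d dD ->] cv]|[d]].
    by exists d => //; rewrite mem_filter cv /= sD.
  rewrite mem_filter => /andP[cd ds] ->; split=> //.
  by apply/imfsetP; exists d => //=; rewrite -sD.
rewrite card_imfset /=; last exact: addrI.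
rewrite undup_id ?filter_uniq // size_filter -sum1_count big_mkcond.
by apply: eq_bigr => d _; case: (c _).
Qed.

(** This makes the input code itself a sufficient margin for the window test. *)
Lemma code_points_bound s (d : int * int) : d \in s ->
  (`|d.1| <= code_points s)%N /\ (`|d.2| <= code_points s)%N.
Proof.
have lt_code l k : k \in l -> (k <= CodeSeq.code l)%N.
  by move=> kl; have /allP/(_ k kl)/ltnW := CodeSeq.ltn_code l.
have le_int z : (`|z| <= code_int z)%N by case: z => k /=; rewrite ?NegzE ?abszN; lia.
move=> ds; have ds' := lt_code _ _ (map_f code_point ds).
by split; apply: leq_trans (le_int _) (leq_trans (lt_code _ _ _) ds');
  rewrite !inE eqxx ?orbT.
Qed.

(** * Tori, windows and compactness *)

Section Windows.

Variables (D : {fset int * int}) (b a : nat) (s : seq (int * int)).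
Hypotheses (us : uniq s) (sD : s =i D).

Lemma torus_covering n : (0 < n)%N ->
  (0 < solutions 0 n (code_points s) b a)%N -> exists c, covering D b a c.
Proof.
move=> n0 /(solutions_gt0P _ _ _ _ n0)[w _ Hw].
exists (fun z => bit w (cell n z)); apply/(covering_sumE _ _ _ us sD) => -[i j].
have mod_nat (z : int) : exists2 k : nat, (z %% n)%Z = k%:Z & (k < n)%N.
  exists `|(z %% n)%Z|%N; first by rewrite gez0_abs // modz_ge0; lia.
  by have := @modz_ge0 z n; have := @ltz_pmod z n; lia.
have [i' ei lti] := mod_nat i; have [j' ej ltj] := mod_nat j.
have := Hw i' j' isT; rewrite !addn0 => /(_ lti isT ltj).
rewrite -ei -ej -[X in if bit w (cell n X) then _ else _]addr0 cell_mod // addr0 => <-.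
by apply: eq_bigr => d _; rewrite cell_mod.
Qed.

Lemma periodic_covering_torus n c : (0 < n)%N -> covering D b a c ->
  (forall u v, c (u + (n%:Z * v.1, n%:Z * v.2)) = c u) ->
  (0 < solutions 0 n (code_points s) b a)%N.
Proof.
move=> n0 /(covering_sumE _ _ _ us sD) cov per; apply/solutions_gt0P => //.
have [w ltw Hw] := bits_exist (fun k => c ((k %/ n)%N%:Z, (k %% n)%N%:Z)) (n * n).
have Ew u : bit w (cell n u) = c u.
  have [h1 h2] : ((u.1 %% n)%Z = `|(u.1 %% n)%Z|%N%:Z) /\
     ((u.2 %% n)%Z = `|(u.2 %% n)%Z|%N%:Z).
    by split; rewrite gez0_abs // modz_ge0; lia.
  have [l1 l2] : (`|(u.1 %% n)%Z| < n)%N /\ (`|(u.2 %% n)%Z| < n)%N.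
    by split; rewrite -ltz_nat -?h1 -?h2 ltz_pmod.
  rewrite /cell Hw; last by nia.
  rewrite divnMDl // modnMDl modn_small // divn_small // addn0 -h1 -h2.
  rewrite -[RHS](per _ (- (u.1 %/ n)%Z, - (u.2 %/ n)%Z)); congr c.
  case: u {h1 h2 l1 l2} => u1 u2 /=; congr pair.
    by rewrite {2}(divz_eq u1 n) /=; lia.
  by rewrite {2}(divz_eq u2 n) /=; lia.
exists w => // i j _ _ _ _; rewrite Ew -cov.
by apply: eq_bigr => d _; rewrite Ew.
Qed.

(** With the code of [D] as margin, the tested sums stay inside the square, where reduction modulo
    [n] is trivial; the restriction of [c] is therefore a solution. *)
Lemma covering_window n c : covering D b a c ->
  (0 < n)%N -> (0 < solutions (code_points s) n (code_points s) b a)%N.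
Proof.
move=> /(covering_sumE _ _ _ us sD) cov n0; apply/solutions_gt0P => //.
have [w ltw Hw] := bits_exist (fun k => c ((k %/ n)%N%:Z, (k %% n)%N%:Z)) (n * n).
have Ew (i j : int) : 0 <= i -> i < n -> 0 <= j -> j < n ->
    bit w (cell n (i, j)) = c (i, j).
  case: i j => [i|//] [j|//] _ lti _ ltj.
  rewrite /cell /= !modz_nat !absz_nat !modn_small // Hw; last by nia.
  by rewrite divnMDl // modnMDl modn_small // divn_small // addn0.
exists w => // i j Mi iM Mj jM; rewrite Ew; try by lia.
rewrite -cov big_seq [RHS]big_seq; apply: eq_bigr => d ds.
have [b1 b2] := code_points_bound ds; case: d b1 b2 {ds} => d1 d2 /= b1 b2.
by rewrite Ew //=; lia.
Qed.

End Windows.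

(** Take an ultrafilter containing all eventual sets and let [c z] be the value of [cs n z] for
    almost all [n]. Finitely many agreements and the bound [N] then hold together on a member of the
    ultrafilter, which is nonempty. *)
Lemma pointwise_limit (T : Type) (cs : nat -> T -> bool) : exists c : T -> bool,
  forall (l : seq T) N, exists2 n, (N <= n)%N & map (cs n) l = map c l.
Proof.
have [U [UU sU]] := filter.ultraFilterLemma filter.eventually_filter.
have UF : filter.Filter U by apply: filter.filter_filter.
exists (fun z => boolp.asbool (U (fun n => cs n z))) => l N.
suff : U (fun n => (N <= n)%N /\
    map (cs n) l = map (fun z => boolp.asbool (U (fun n => cs n z))) l).
  by move=> /filter.filter_ex[n []]; exists n.
elim: l => [|z l IH].
  by apply: filter.filterS (sU [eta leq N] _) => //; exists N.
suff Uz : U (fun n => cs n z = boolp.asbool (U (fun n => cs n z))).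
  by apply: filter.filterS (filter.filterI IH Uz) => n [[leN /= ->] ->].
have [Hz|Hz] := filter.in_ultra_setVsetC (fun n => cs n z) UU.
  by apply: filter.filterS (Hz) => n; rewrite boolp.asboolT.
have nz : ~ U (fun n => cs n z).
  move=> Hz'; have [n []] := filter.filter_ex (filter.filterI Hz Hz').
  by move=> /= h /h.
by apply: filter.filterS (Hz) => n; rewrite boolp.asboolF // => /negP/negbTE.
Qed.

Lemma windows_covering D b a (s : seq (int * int)) : uniq s -> s =i D ->
  (forall n, (0 < n)%N ->
     (0 < solutions (code_points s) n (code_points s) b a)%N) ->
  exists c, covering D b a c.
Proof.
move=> us sD; set M := code_points s => H.
have /boolp.choice[w Hw] n : exists w, forall i j : nat,
    (M <= i)%N -> (i + M < n.+1)%N -> (M <= j)%N -> (j + M < n.+1)%N ->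
    (\sum_(d <- s) bit w (cell n.+1 ((i%:Z, j%:Z) + d)%R))%N =
      if bit w (cell n.+1 (i%:Z, j%:Z)) then b else a.
  by have [w _ Hw] := (solutions_gt0P M s b a (ltn0Sn n)).1 (H n.+1 isT); exists w.
(* Windows are recentred at their midpoints, so that every fixed point eventually lies deep inside
   them. *)
pose center n : int * int := (n./2%:Z, n./2%:Z).
have [c Hc] := pointwise_limit (fun n z => bit (w n) (cell n.+1 (center n + z))).
exists c; apply/(covering_sumE _ _ _ us sD) => u.
(* The bound puts [n./2] above [|u.1| + |u.2| + M], so the recentred [u] is in the tested region. *)
have [n len /= [e0 el]] := Hc (u :: [seq u + d | d <- s])
   (`|u.1| + `|u.2| + M).+1.*2.
have len2 : (`|u.1| + `|u.2| + M < n./2)%N by lia.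
have [i ei] : exists i : nat, i%:Z = n./2%:Z + u.1.
  by exists (absz (n./2%:Z + u.1)); lia.
have [j ej] : exists j : nat, j%:Z = n./2%:Z + u.2.
  by exists (absz (n./2%:Z + u.2)); lia.
have := Hw n i j.
have eu : (i%:Z, j%:Z) = center n + u by case: (u) ei ej => u1 u2 /= -> ->.
rewrite eu e0 => <-; try by lia.
rewrite -(big_map (fun d => u + d) xpredT (fun v => nat_of_bool (c v))).
rewrite -(big_map c xpredT nat_of_bool) -el !big_map.
by apply: eq_bigr => d _; rewrite addrA.
Qed.

(** If a covering exists, a doubly periodic one ends the search and no window can fail, so the
    output is 1. Otherwise no torus succeeds and compactness supplies a failing window, so the
    output is 0. *)
Lemma decision_by_search : exists p : recfun,
  forall D b a s, uniq s -> s =i D ->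
  ((exists c, covering D b a c) ->
   exists c n, [/\ covering D b a c, (0 < n)%N
     & forall u v, c (u + (n%:Z * v.1, n%:Z * v.2)) = c u]) ->
  ((exists c, covering D b a c) -> eval p [:: code_points s; b; a] 1)
  /\ (~ (exists c, covering D b a c) -> eval p [:: code_points s; b; a] 0).
Proof.
have [p Hp] := decision_program; exists p => D b a s us sD per; split.
  move=> ex; have [c [n [cov n0 cper]]] := per ex.
  have pn := periodic_covering_torus us sD n0 cov cper.
  have [|m [dm _]] := Hp (code_points s) b a.
    by exists n; rewrite /decided /periodic_found n0 pn.
  suff -> : periodic_found m (code_points s) b a by [].
  move: dm; rewrite /decided => /orP[//|/andP[m0]].
  by rewrite -leqn0 leqNgt (covering_window us sD cov m0).
move=> nex.
have npf n : periodic_found n (code_points s) b a = false.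
  by apply/negP => /andP[n0] /(torus_covering us sD n0).
have [|m [_ _]] := Hp (code_points s) b a; last by rewrite npf.
apply: boolp.contrapT => /boolp.forallNP nd.
apply/nex/(windows_covering us sD) => n n0.
by have := nd n; rewrite /decided n0 lt0n => /negP; rewrite negb_or => /andP[].
Qed.

(** * From one period to two *)

Lemma pigeonhole_nat (T : finType) (f : nat -> T) :
  exists i j, [/\ (i < j)%N, (j <= #|T|)%N & f i = f j].
Proof.
have /injectivePn[i [j nij fij]] : ~~ injectiveb (fun i : 'I_#|T|.+1 => f i).
  by apply/negP => /injectiveP /leq_card; rewrite card_ord ltnn.
have : (i != j :> nat) by rewrite val_eqE.
rewrite neq_ltn => /orP[lt|lt].
  by exists i, j; split=> //; rewrite -ltnS.
by exists j, i; split=> //; rewrite -ltnS.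
Qed.

Definition scale (k : int) (v : int * int) : int * int := (k * v.1, k * v.2).

Lemma scaleD k l v : scale (k + l) v = scale k v + scale l v.
Proof. by rewrite /scale !mulrDl. Qed.

Lemma scale0 v : scale 0 v = 0.
Proof. by rewrite /scale !mul0r. Qed.

Lemma scale1 v : scale 1 v = v.
Proof. by rewrite /scale !mul1r; case: v. Qed.

Lemma scaleA k l v : scale k (scale l v) = scale (k * l) v.
Proof. by rewrite /scale /= !mulrA. Qed.

Lemma scaleN k v : scale (- k) v = - scale k v.
Proof. by rewrite /scale !mulNr. Qed.

Lemma periodic_scale (T : Type) (f : int * int -> T) v :
  (forall u, f (u + v) = f u) -> forall k u, f (u + scale k v) = f u.
Proof.
move=> per k u; elim: k u => [|k IH|k IH] u.
- by rewrite scale0 addr0.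
- by rewrite intS scaleD scale1 addrA IH per.
- by rewrite intS opprD scaleD [scale (-1) v]scaleN scale1 addrA IH -per subrK.
Qed.

(* [ht] is constant along [p], so finitely many values determine a [p]-periodic
   configuration on a slab of bounded [ht].  Two equal slabs are matched and the
   strip between them is repeated. *)
Section Periodize.

Variable p : int * int.
Hypothesis p0 : p != 0.

Let ht (u : int * int) := p.1 * u.2 - p.2 * u.1.
Let delta := p.1 ^+ 2 + p.2 ^+ 2.

Let delta_gt0 : 0 < delta.
Proof.
rewrite /delta; have := sqr_ge0 p.1; have := sqr_ge0 p.2.
have : (p.1 ^+ 2 != 0) || (p.2 ^+ 2 != 0).
  rewrite !sqrf_eq0 -negb_and; apply: contra p0 => /andP[/eqP e1 /eqP e2].
  by rewrite -pair_eqE /= e1 e2.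
by move: (p.1 ^+ 2) (p.2 ^+ 2) => x y; lia.
Qed.

(** Subtracting a multiple of [p] reduces the inner product with [p] to its remainder [r] modulo
    [delta], the squared length of [p]; Cramer's rule then bounds both coordinates in terms of [r]
    and [ht u]. *)
Lemma slab_reduction (H : int) u : `|ht u| <= H ->
  exists k, let B := (`|p.1| + `|p.2|) * (delta + H) in
    `|(u - scale k p).1| <= B /\ `|(u - scale k p).2| <= B.
Proof.
move=> htu; exists ((p.1 * u.1 + p.2 * u.2) %/ delta)%Z => /=.
set k := (_ %/ _)%Z.
have [r [er r0 rd]] : exists r, [/\ p.1 * u.1 + p.2 * u.2 = k * delta + r, 0 <= r & r < delta].
  exists ((p.1 * u.1 + p.2 * u.2) %% delta)%Z; split; first exact: divz_eq.
    by rewrite modz_ge0 // gt_eqF.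
  by rewrite ltz_pmod.
have bound (x y z : int) : delta * x = y * r + z * ht u ->
    `|x| <= (`|y| + `|z|) * (delta + H).
  move=> e; apply: (@le_trans _ _ `|delta * x|).
    by rewrite normrM (gtr0_norm delta_gt0) ler_peMl // -gtz0_ge1.
  rewrite e; apply: le_trans (ler_normD _ _) _; rewrite !normrM (ger0_norm r0).
  rewrite mulrDl; apply: lerD; apply: ler_wpM2l => //.
    by apply: ler_wpDr (ltW rd); apply: le_trans (normr_ge0 _) htu.
  by apply: le_trans htu _; rewrite lerDr ltW.
have e1 : delta * (u - scale k p).1 = p.1 * r + - p.2 * ht u.
  have -> : r = p.1 * u.1 + p.2 * u.2 - k * delta by rewrite er addrC addKr.
  by rewrite /ht /delta /=; ring.
have e2 : delta * (u - scale k p).2 = p.2 * r + p.1 * ht u.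
  have -> : r = p.1 * u.1 + p.2 * u.2 - k * delta by rewrite er addrC addKr.
  by rewrite /ht /delta /=; ring.
split; first by rewrite -(normrN p.2); apply: bound e1.
by rewrite [X in _ <= X * _]addrC; apply: bound e2.
Qed.

(** Modulo [p] the slab fits into a box of side [B + B + 1], so it carries finitely many patterns
    and two translates along [t] agree. *)
Lemma slab_repetition (H : int) (t : int * int) (c : int * int -> bool) :
  (forall u, c (u + p) = c u) ->
  exists i j : nat, (i < j)%N /\
    forall u, `|ht u| <= H -> c (u + scale i t) = c (u + scale j t).
Proof.
move=> per; pose B := absz ((`|p.1| + `|p.2|) * (delta + H))%R.
have [i [j [ltij _ eij]]] := pigeonhole_nat (fun i =>
  [ffun z : 'I_(B + B).+1 * 'I_(B + B).+1 =>
     c ((z.1%:Z - B%:Z, z.2%:Z - B%:Z) + scale i t)]).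
exists i, j; split=> // u /slab_reduction[k /= [b1 b2]].
have ub (x : int) : `|x| <= (`|p.1| + `|p.2|) * (delta + H) ->
    exists z : 'I_(B + B).+1, z%:Z - B%:Z = x.
  move=> bx; have lz : (absz (x + B%:Z)%R < (B + B).+1)%N by lia.
  by exists (Ordinal lz) => /=; lia.
have [z1 ez1] := ub _ b1; have [z2 ez2] := ub _ b2.
have := congr1 (fun f : {ffun _ -> _} => f (z1, z2)) eij.
rewrite !ffunE /= ez1 ez2 -[(u.1 - _, _)]/(u - scale k p).
by rewrite 2!(addrAC _ (- scale k p)) -!scaleN !(periodic_scale per).
Qed.

Lemma torus_periodic_covering (D : {fset int * int}) b a c : covering D b a c ->
  (forall u, c (u + p) = c u) ->
  exists c' n, [/\ covering D b a c', (0 < n)%N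
    & forall u v, c' (u + (n%:Z * v.1, n%:Z * v.2)) = c' u].
Proof.
move=> /(covering_sumE _ _ _ (fset_uniq D) (fun _ => erefl)) cov per.
(* No displacement in [D] changes [ht] by more than [H]. *)
pose H : int := \sum_(d <- D) `|ht d|.
have H0 : 0 <= H by rewrite sumr_ge0.
have htD d : d \in (D : seq _) -> `|ht d| <= H.
  move=> dD; rewrite /H (big_rem d) //= ler_wpDr // sumr_ge0 //.
(* A multiple of [p] turned by a right angle, with [ht t = (H + 1) * delta > H]. *)
pose t : int * int := scale (H + 1) (- p.2, p.1).
have [i [j [ltij eij]]] := slab_repetition H t per.
pose c0 u := c (u + scale i t).
pose P : int := j%:Z - i%:Z.
(* [q] is the value of [ht] at [scale P t], the translation that relates the two equal slabs; the
   strip [0 <= ht < q] will be repeated. *)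
pose q := P * ((H + 1) * delta).
have htt k u : ht (u + scale (k * P) t) = ht u + k * q.
  by rewrite /ht /q /t /delta /=; ring.
have P0 : 0 < P by rewrite /P; lia.
have Hq : H < q by rewrite /q; move: delta_gt0 P0 H0; nia.
have q0 : 0 < q by lia.
have per0 u : c0 (u + p) = c0 u by rewrite /c0 addrAC per.
have rep u : `|ht u| <= H -> c0 (u + scale P t) = c0 u.
  move=> hu; rewrite /c0 (eij _ hu) -addrA -scaleD; congr (c (_ + scale _ _)).
  by rewrite /P; lia.
pose red u := u + scale (- (ht u %/ q)%Z * P) t.
pose c' u := c0 (red u).
have htred u : ht (red u) = (ht u %% q)%Z by rewrite /red htt /modz mulNr.
(* From a point of the strip, [d] leads at most one strip up or down, and then to within [H] of the
   border crossed, where [rep] identifies the two copies. *)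
have shift u d : `|ht d| <= H -> c' (u + d) = c0 (red u + d).
  move=> hd; have htD2 x y : ht (x + y) = ht x + ht y by rewrite /ht /=; ring.
  have b0 : 0 <= ht (red u) by rewrite htred modz_ge0 // gt_eqF.
  have b1 : ht (red u) < q by rewrite htred ltz_pmod.
  have [k [ek hk]] : exists k, [/\ ((ht (u + d) %/ q)%Z = (ht u %/ q)%Z + k)
     & [\/ k = 0, k = -1 /\ - H <= ht (red u + d) < 0
        | k = 1 /\ q <= ht (red u + d) <= q + H]].
    exists (ht (red u + d) %/ q)%Z; split.
      rewrite {1}(_ : ht (u + d) = (ht u %/ q)%Z * q + ht (red u + d)).
        by rewrite divzMDl // gt_eqF.
      by rewrite (htD2 u) (htD2 (red u)) htred {1}(divz_eq (ht u) q) -addrA.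
    rewrite (htD2 (red u)); set x := ht (red u) + ht d.
    have xb : - H <= x <= q + H by rewrite /x; lia.
    have [x0|x0] := ltrP x 0.
      apply: Or32; split; last by lia.
      by have := divz_eq x q; have := @modz_ge0 x q; have := @ltz_pmod x q; nia.
    have [xq|xq] := ltrP x q.
      by apply: Or31; apply: divz_small; rewrite x0 /=; lia.
    apply: Or33; split; last by lia.
    by have := divz_eq x q; have := @modz_ge0 x q; have := @ltz_pmod x q; nia.
  have -> : c' (u + d) = c0 (red u + d + scale (- k * P) t).
    rewrite /c' /red ek; congr c0; rewrite -!addrA; congr (_ + _).
    rewrite [RHS]addrCA -scaleD; congr (_ + scale _ _); ring.
  case: hk => [->|[-> hk]|[-> hk]].
  - by rewrite oppr0 mul0r scale0 addr0.
  - by rewrite opprK mul1r rep //; lia.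
  - rewrite mulN1r -rep ?scaleN ?subrK // -scaleN.
    by rewrite -mulN1r htt; lia.
have c'per u : c' (u + p) = c' u.
  rewrite /c' /red.
  have -> : ht (u + p) = ht u by rewrite /ht /=; ring.
  by rewrite addrAC per0.
have c'per2 u : c' (u + scale P t) = c' u.
  have e : (ht (u + scale P t) %/ q)%Z = (ht u %/ q)%Z + 1.
    rewrite -[P]mul1r htt mul1r addrC -[X in X + _]mul1r divzMDl ?gt_eqF //.
    by rewrite addrC.
  rewrite /c' /red e.
  by congr c0; rewrite -addrA -scaleD; congr (_ + scale _ _); ring.
(* Since [delta * v] is a combination of [p] and its right-angle rotation, this multiple of any [v]
   lies in the lattice spanned by [p] and [scale P t]. *)
exists c', (absz (delta * (P * (H + 1)))); split.
- apply/(covering_sumE _ _ _ (fset_uniq D) (fun _ => erefl)) => u.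
  have covr : forall u, (\sum_(d <- D) c0 (u + d)%R)%N = if c0 u then b else a.
    by move=> x; rewrite -cov; apply: eq_bigr => d _; rewrite /c0 addrAC.
  rewrite -[u in RHS]addr0 shift; last by rewrite /ht !mulr0 subr0 normr0.
  rewrite addr0 -covr big_seq [RHS]big_seq; apply: eq_bigr => d dD.
  by rewrite shift ?htD.
- by rewrite absz_gt0 gt_eqF // !mulr_gt0 //; lia.
- move=> u v; rewrite gez0_abs; last by rewrite !mulr_ge0 //; lia.
  rewrite (_ : (_, _) = scale ((P * (H + 1)) * (p.1 * v.1 + p.2 * v.2)) p
     + scale (p.1 * v.2 - p.2 * v.1) (scale P t)).
    by rewrite addrA (periodic_scale c'per2) (periodic_scale c'per).
  by rewrite /scale /t /delta; congr pair => /=; ring.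
Qed.

End Periodize.

(** * Annihilators of bounded configurations *)

(** The common shape of the actions of polynomials in one and in two variables on arrays. *)
Definition coef_fold (A : nzRingType) (M : zmodType) (phi : nat -> A -> M)
  (P : {poly A}) : M := \sum_(k < size P) phi k P`_k.

Section CoefSum.

Variables (A : nzRingType) (M : zmodType) (phi : nat -> A -> M).
Hypothesis phiD : forall k x y, phi k (x + y) = phi k x + phi k y.

Lemma coef_fold_widen n (P : {poly A}) :
  (size P <= n)%N -> coef_fold phi P = \sum_(k < n) phi k P`_k.
Proof.
have phi0 k : phi k 0 = 0 by apply: (addrI (phi k 0)); rewrite -phiD !addr0.
move=> le; rewrite /coef_fold (big_ord_widen n (fun k => phi k P`_k)) // big_mkcond.
by apply: eq_bigr => k _; case: ltnP => // /(nth_default 0) ->.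
Qed.

Lemma coef_foldD P Q : coef_fold phi (P + Q) = coef_fold phi P + coef_fold phi Q.
Proof.
rewrite (coef_fold_widen (size_polyD P Q)) (coef_fold_widen (leq_maxl (size P) (size Q))).
rewrite (coef_fold_widen (leq_maxr (size P) (size Q))) -big_split.
by apply: eq_bigr => k _; rewrite coefD phiD.
Qed.

Lemma coef_foldXM P : coef_fold phi ('X * P) = coef_fold (fun k => phi k.+1) P.
Proof.
have le : (size ('X * P)%R <= (size P).+1)%N.
  by apply: leq_trans (size_polyMleq _ _) _; rewrite size_polyX.
rewrite (coef_fold_widen le) big_ord_recl coefXM /=.
have -> : phi 0 0 = 0 by apply: (addrI (phi 0 0)); rewrite -phiD !addr0.
by rewrite add0r; apply: eq_bigr => k _; rewrite coefXM.
Qed.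

Lemma coef_foldCM c P :
  coef_fold phi (c%:P * P) = coef_fold (fun k x => phi k (c * x)) P.
Proof.
have le : (size (c%:P * P)%R <= size P)%N.
  by rewrite mul_polyC; apply: size_scale_leq.
by rewrite (coef_fold_widen le); apply: eq_bigr => k _; rewrite coefCM.
Qed.

Lemma coef_foldC c : coef_fold phi c%:P = phi 0%N c.
Proof.
by rewrite (@coef_fold_widen 1) ?size_polyC_leq1 // big_ord1 coefC.
Qed.

End CoefSum.

(* A polynomial in two variables acts on two-dimensional arrays, the variables
   acting as the two shifts; the annihilator of an array is an ideal. *)
Section Frobenius.

Variables (F : comNzRingType) (e : nat -> nat -> F).

Let ev i j (P : {poly {poly F}}) : F :=
  coef_fold (fun k => coef_fold (fun l x => x * e (i + k) (j + l))) P.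

Let phiD i j k x y : coef_fold (fun l x => x * e (i + k) (j + l)) (x + y) =
  coef_fold (fun l x => x * e (i + k) (j + l)) x +
  coef_fold (fun l x => x * e (i + k) (j + l)) y.
Proof. by rewrite coef_foldD // => l ? ?; rewrite mulrDl. Qed.

Let evD i j P Q : ev i j (P + Q) = ev i j P + ev i j Q.
Proof. by rewrite /ev coef_foldD. Qed.

Let ev0 i j : ev i j 0 = 0.
Proof. by rewrite /ev /coef_fold size_poly0 big_ord0. Qed.

Let evX i j P : ev i j ('X * P) = ev i.+1 j P.
Proof.
rewrite /ev coef_foldXM //; apply: eq_bigr => k _; apply: eq_bigr => l _.
by rewrite addnS.
Qed.

Let evCX i j P : ev i j ('X%:P * P) = ev i j.+1 P.
Proof.
rewrite /ev coef_foldCM //; apply: eq_bigr => k _; rewrite coef_foldXM.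
  by apply: eq_bigr => l _; rewrite addnS.
by move=> l x y; rewrite mulrDl.
Qed.

Let evCC a i j P : ev i j (a%:P%:P * P) = a * ev i j P.
Proof.
rewrite /ev coef_foldCM // mulr_sumr; apply: eq_bigr => k _.
rewrite coef_foldCM; last by move=> l x y; rewrite mulrDl.
by rewrite mulr_sumr; apply: eq_bigr => l _; rewrite mulrA.
Qed.

Let ev_ideal P Q : (forall i j, ev i j P = 0) -> forall i j, ev i j (Q * P) = 0.
Proof.
move=> HP.
have HC c Q' : (forall i j, ev i j Q' = 0) -> forall i j, ev i j (c%:P * Q') = 0.
  move=> HQ; elim/poly_ind: c => [|c a IH] i j; first by rewrite mul0r ev0.
  by rewrite mulrC polyCD polyCM mulrDr evD mulrA mulrC evCX mulrC IH mulrC evCC HQ mulr0 addr0.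
elim/poly_ind: Q => [|Q c IH] i j; first by rewrite mul0r ev0.
by rewrite mulrDl evD HC // -mulrA mulrCA evX IH addr0.
Qed.

Let mono a k l : {poly {poly F}} := 'X ^+ k * ('X%:P ^+ l * a%:P%:P).

Let ev_mono a k l i j : ev i j (mono a k l) = a * e (i + k) (j + l).
Proof.
rewrite /mono; elim: k i => [|k IH] i; last by rewrite exprS -mulrA evX IH addSnnS.
rewrite expr0 mul1r addn0; elim: l j => [|l IH] j; last first.
  by rewrite exprS -mulrA evCX IH addSnnS.
rewrite expr0 mul1r addn0 -[_%:P]mulr1 evCC /ev -[1]/(1%:P) coef_foldC //.
rewrite -[1]/(1%:P) coef_foldC ?addn0 ?mul1r //.
by move=> ? ? ?; rewrite mulrDl.
Qed.

(** The power [P ^+ p] is a multiple of [P] and so annihilates the array; in characteristic [p] it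
    is the sum of the [p]-th powers of the monomials of [P]. *)
Lemma frobenius_dilation p (L : seq (F * (nat * nat))) : p \in [pchar F] ->
  (forall i j, \sum_(x <- L) x.1 * e (i + x.2.1) (j + x.2.2) = 0) ->
  forall i j, \sum_(x <- L) x.1 ^+ p * e (i + x.2.1 * p) (j + x.2.2 * p) = 0.
Proof.
move=> charF HL i j.
have ev_sum (G : F * (nat * nat) -> {poly {poly F}}) i' j' :
    ev i' j' (\sum_(x <- L) G x) = \sum_(x <- L) ev i' j' (G x).
  by apply: (big_morph (ev i' j')); [exact: evD | exact: ev0].
pose P := \sum_(x <- L) mono x.1 x.2.1 x.2.2.
have HP i' j' : ev i' j' P = 0.
  by rewrite ev_sum -[RHS](HL i' j'); apply: eq_bigr => x _; rewrite ev_mono.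
have charP : p \in [pchar {poly {poly F}}] by rewrite !pchar_poly.
have EP : P ^+ p = \sum_(x <- L) mono (x.1 ^+ p) (x.2.1 * p) (x.2.2 * p).
  rewrite -(pFrobenius_autE charP) rmorph_sum; apply: eq_bigr => x _ /=.
  by rewrite pFrobenius_autE /mono !exprMn -!exprM -!rmorphXn.
have p0 : (0 < p)%N by apply/prime_gt0/(pcharf_prime charF).
have := @ev_ideal P (P ^+ p.-1) HP i j.
rewrite -exprSr prednK // EP ev_sum => E; rewrite -[RHS]E.
by apply: eq_bigr => x _; rewrite ev_mono.
Qed.

End Frobenius.

Definition act (A : nzRingType) (L : seq (A * (int * int))) (f : int * int -> A)
  (u : int * int) : A := \sum_(x <- L) x.1 * f (u + x.2).

Lemma act_comm (A : comNzRingType) (L L' : seq (A * (int * int))) f u :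
  act L (act L' f) u = act L' (act L f) u.
Proof.
rewrite /act; under eq_bigr => x _ do rewrite mulr_sumr.
rewrite exchange_big; apply: eq_bigr => y _; rewrite mulr_sumr.
by apply: eq_bigr => x _; rewrite mulrCA addrAC.
Qed.

(** Modulo [p] the Frobenius map fixes the coefficients and dilates the displacements. The dilated
    sum is thus divisible by [p], and its absolute value is below [p]. *)
Lemma dilation_prime (L : seq (int * (int * int))) e (B : int) p :
  prime p -> (forall u, `|e u| <= B) -> B * \sum_(x <- L) `|x.1| < p ->
  (forall u, act L e u = 0) ->
  forall u, act [seq (x.1, scale p x.2) | x <- L] e u = 0.
Proof.
move=> pr bB ltp HL u.
(* Adding [K] makes the displacements natural numbers; the origin [o] compensates, so that after
   dilation [o + p (x + K)] is [u + p x]. *)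
pose K : int := \sum_(x <- L) (`|x.2.1| + `|x.2.2|).
have HK x : x \in L -> 0 <= x.2.1 + K /\ 0 <= x.2.2 + K.
  move=> xL; have : `|x.2.1| + `|x.2.2| <= K.
    by rewrite /K (big_rem x) //= lerDl sumr_ge0.
  by lia.
pose o : int * int := u - (p%:Z * K, p%:Z * K).
pose e' i j : 'F_p := (e (o + (i%:Z, j%:Z)))%:~R.
pose L' := [seq (x.1%:~R : 'F_p, (absz (x.2.1 + K)%R, absz (x.2.2 + K)%R)) | x <- L].
have /(frobenius_dilation (pchar_Fp pr)) HF : forall i j,
    \sum_(x <- L') x.1 * e' (i + x.2.1)%N (j + x.2.2)%N = 0.
  move=> i j; rewrite big_map /=; have := HL (o + (i%:Z + K, j%:Z + K)).
  move=> E.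
  rewrite -[RHS]/(0%:~R) -E /act rmorph_sum /=.
  rewrite big_seq [RHS]big_seq; apply: eq_bigr => x /HK[k1 k2].
  rewrite rmorphM /= /e' !PoszD !gez0_abs //; congr (_ * (e _)%:~R).
  by rewrite -[in RHS]addrA; congr (_ + _); apply: injective_projections => /=; ring.
have S0 : (act [seq (x.1, scale p x.2) | x <- L] e u)%:~R = 0 :> 'F_p.
  rewrite -[RHS](HF 0%N 0%N) /act !big_map rmorph_sum /= big_seq [RHS]big_seq.
  apply: eq_bigr => x /HK[k1 k2]; rewrite rmorphM /= /e' !add0n.
  have -> : (x.1%:~R : 'F_p) ^+ p = x.1%:~R.
    by rewrite -[RHS]expf_card card_Fp.
  rewrite !PoszM !gez0_abs //; congr (_ * (e _)%:~R); rewrite /o /scale.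
  by case: (u) => u1 u2; apply: injective_projections => /=; ring.
apply/eqP; rewrite -absz_eq0; move/eqP: S0; rewrite -(dvdz_pcharf (pchar_Fp pr)).
rewrite /dvdz /= => dv; apply/negPn/negP; rewrite -lt0n => /(fun h => dvdn_leq h dv).
apply/negP; rewrite -ltnNge -ltz_nat abszE; apply: le_lt_trans ltp.
rewrite /act big_map mulr_sumr; apply: le_trans (ler_norm_sum _ _ _) _.
by apply: ler_sum => x _; rewrite normrM mulrC ler_wpM2r.
Qed.

(** Take [q = C!], where [C] bounds the sums in absolute value: a prime factor of [1 + q k] exceeds
    [C]. Dilation keeps the coefficients, hence also [C], so prime factors can be applied one at a
    time. *)
Lemma dilation (L : seq (int * (int * int))) e (B : int) :
  (forall u, `|e u| <= B) -> (forall u, act L e u = 0) ->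
  exists2 q : nat, (0 < q)%N & forall (k : nat) u,
    act [seq (x.1, scale (1 + q%:Z * k%:Z) x.2) | x <- L] e u = 0.
Proof.
move=> bB HL; pose C := absz (B * \sum_(x <- L) `|x.1|)%R.
exists C`!; first exact: fact_gt0.
suff H n : (0 < n)%N -> (forall p, prime p -> (p %| n)%N -> (C < p)%N) ->
    forall u, act [seq (x.1, scale n x.2) | x <- L] e u = 0.
  move=> k u; rewrite -(PoszM C`!) -(PoszD 1); apply: H => // p pr dv.
  rewrite ltnNge; apply/negP => le.
  have dC : (p %| C`!)%N by apply: dvdn_fact; rewrite prime_gt0.
  by move: dv; rewrite dvdn_addl ?dvdn1 ?dvdn_mulr // => /eqP ep; rewrite ep in pr.
elim/ltn_ind: n => n IH n0 Hn.
have [n1|n1] := leqP n 1.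
  have -> : n = 1%N by lia.
  by move=> u; rewrite /act big_map -[RHS](HL u); apply: eq_bigr => x _; rewrite scale1.
have pr := pdiv_prime n1; have [m em] := dvdnP (pdiv_dvd n).
have m0 : (0 < m)%N by case: (m) em => // em; move: n0; rewrite em.
have Hm : forall u, act [seq (x.1, scale m x.2) | x <- L] e u = 0.
  apply: IH => //.
    by rewrite [X in (_ < X)%N]em ltn_Pmulr // prime_gt1.
  by move=> p prp dv; apply: Hn => //; rewrite em dvdn_mulr.
move=> u; rewrite em.
have := dilation_prime pr bB _ Hm u; rewrite big_map => /(_ _) E.
rewrite -[RHS]E.
  by rewrite /act !big_map; apply: eq_bigr => x _; rewrite /= scaleA -PoszM mulnC.
have := Hn _ pr (pdiv_dvd n); rewrite -ltz_nat; apply: le_lt_trans.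
by rewrite /C abszE ler_norm.
Qed.

(** * Difference operators and elimination of terms *)

Definition diff (A : zmodType) (w : int * int) (f : int * int -> A)
  (u : int * int) : A := f (u + w) - f u.

Fixpoint diffs (A : zmodType) (ws : seq (int * int)) (f : int * int -> A) :
    int * int -> A :=
  if ws is w :: ws' then diffs ws' (diff w f) else f.

Lemma eq_diffs (A : zmodType) ws (f g : int * int -> A) :
  f =1 g -> diffs ws f =1 diffs ws g.
Proof.
elim: ws f g => //= w ws IH f g efg; apply: IH => u.
by rewrite /diff !efg.
Qed.

Lemma diffs_shift (A : zmodType) ws (f : int * int -> A) t u :
  diffs ws (fun z => f (z + t)) u = diffs ws f (u + t).
Proof.
elim: ws f u => //= w ws IH f u; rewrite -IH; apply: eq_diffs => z.
by rewrite /diff addrAC.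
Qed.

Lemma diffs_diff (A : zmodType) ws w (f : int * int -> A) u :
  diffs ws (diff w f) u = diff w (diffs ws f) u.
Proof.
elim: ws f u => //= w' ws IH f u; rewrite -IH; apply: eq_diffs => z.
by rewrite /diff (addrAC z) !opprB addrACA [RHS]addrACA; congr (_ + _); rewrite addrC.
Qed.

(* Subtracting the relation for [k], translated by [b1], from the one for [k.+1]
   eliminates the summand [f1] with displacement [b1]. *)
Lemma diffs_family (A : zmodType) (fs : seq ((int * int -> A) * (int * int))) f0 b0 :
  (forall (k : nat) u,
     f0 (u + scale k b0) + \sum_(x <- fs) x.1 (u + scale k x.2) = 0) ->
  forall u, diffs [seq b0 - x.2 | x <- fs] f0 u = 0.
Proof.
move en: (size fs) => n; elim: n fs f0 en => [|n IH] [|[f1 b1] fs] f0 //= => [_|[en]] H u.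
  by have := H 0%N u; rewrite big_nil scale0 !addr0.
pose fs' := [seq (fun z => x.1 (z + x.2) - x.1 (z + b1), x.2) | x <- fs].
(* This is the difference of [f0] along [b0 - b1], translated by [b1]; hence the evaluation at
   [u - b1] below. *)
pose f0' z := f0 (z + b0) - f0 (z + b1).
have : diffs [seq b0 - x.2 | x <- fs'] f0' (u - b1) = 0.
  apply: IH => [|k z]; first by rewrite size_map.
  have := H k (z + b1); have := H k.+1 z; rewrite !big_cons big_map /=.
  have E b : z + scale k.+1 b = z + scale k b + b.
    by rewrite intS scaleD scale1 [b + _]addrC addrA.
  move=> H1 H2; rewrite -[RHS]subr0 -[X in _ = X - _]H1 -[X in _ = _ - X]H2.
  rewrite opprD addrACA [in RHS]opprD [X in _ = _ + X]addrACA !E.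
  rewrite (addrAC z b1 (scale k b1)) subrr add0r (addrAC z b1) -sumrB.
  congr (_ + _); apply: eq_bigr => x _.
  by rewrite E (addrAC z b1).
rewrite -map_comp => e; rewrite -[RHS]e -{1}(subrK b1 u) -(diffs_shift _ _ b1).
by apply: eq_diffs => z; rewrite /f0' /diff -(addrA z) (addrC b1) subrK.
Qed.

(** * Recurrences along one direction *)

Definition poly_act (A : nzRingType) (t : int * int) (P : {poly A})
  (f : int * int -> A) (u : int * int) : A :=
  coef_fold (fun i x => x * f (u + scale i%:Z t)) P.

Section PolyAct.

Variables (A : comNzRingType) (t : int * int).

Lemma poly_actD P Q (f : int * int -> A) u :
  poly_act t (P + Q) f u = poly_act t P f u + poly_act t Q f u.
Proof. by rewrite /poly_act coef_foldD // => i x y; rewrite mulrDl. Qed.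

Lemma poly_actXM P (f : int * int -> A) u :
  poly_act t ('X * P) f u = poly_act t P f (u + t).
Proof.
rewrite /poly_act coef_foldXM; last by move=> i x y; rewrite mulrDl.
by apply: eq_bigr => i _; rewrite intS scaleD scale1 addrA.
Qed.

Lemma poly_actCM c P (f : int * int -> A) u :
  poly_act t (c%:P * P) f u = c * poly_act t P f u.
Proof.
rewrite /poly_act coef_foldCM; last by move=> i x y; rewrite mulrDl.
by rewrite mulr_sumr; apply: eq_bigr => i _; rewrite mulrA.
Qed.

Lemma poly_act0 (f : int * int -> A) u : poly_act t 0 f u = 0.
Proof. by rewrite /poly_act /coef_fold size_poly0 big_ord0. Qed.

Lemma poly_act1 (f : int * int -> A) u : poly_act t 1 f u = f u.
Proof.
rewrite /poly_act -[1]/(1%:P) coef_foldC ?scale0 ?addr0 ?mul1r //.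
by move=> i x y; rewrite mulrDl.
Qed.

Lemma poly_act_sum (I : Type) (r : seq I) (P : I -> {poly A}) f u :
  poly_act t (\sum_(i <- r) P i) f u = \sum_(i <- r) poly_act t (P i) f u.
Proof.
by apply: (big_morph (fun Q => poly_act t Q f u)) => [? ?|];
  [apply: poly_actD | apply: poly_act0].
Qed.

Lemma poly_actM P Q (f : int * int -> A) u :
  poly_act t (P * Q) f u = poly_act t P (poly_act t Q f) u.
Proof.
elim/poly_ind: P u => [|P c IH] u; first by rewrite mul0r !poly_act0.
rewrite mulrDl !poly_actD poly_actCM -[c%:P]mulr1 poly_actCM poly_act1.
by rewrite (mulrC P 'X) -mulrA !poly_actXM IH.
Qed.

Lemma poly_act_monomial c n (f : int * int -> A) u :
  poly_act t (c *: 'X^n) f u = c * f (u + scale n%:Z t).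
Proof.
rewrite -mul_polyC poly_actCM; congr (_ * _).
elim: n u => [|n IH] u; first by rewrite expr0 poly_act1 scale0 addr0.
by rewrite exprS poly_actXM IH intS scaleD scale1 addrA.
Qed.

Lemma eq_poly_act P (f g : int * int -> A) :
  f =1 g -> poly_act t P f =1 poly_act t P g.
Proof. by move=> efg u; apply: eq_bigr => i _; rewrite efg. Qed.

Lemma poly_act_eq0 P u : poly_act t P (fun=> 0 : A) u = 0.
Proof. by rewrite /poly_act /coef_fold big1 // => i _; rewrite mulr0. Qed.

Lemma poly_actE P (f : int * int -> A) u :
  poly_act t P f u = act [seq (P`_i, scale i%:Z t) | i <- iota 0 (size P)] f u.
Proof.
rewrite /act big_map; have <- : iota 0 (size P - 0) = iota 0 (size P) by rewrite subn0.
by rewrite -/(index_iota 0 (size P)) big_mkord.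
Qed.

End PolyAct.

Lemma eq_act (A : nzRingType) (L : seq (A * (int * int))) f g :
  f =1 g -> act L f =1 act L g.
Proof. by move=> efg u; apply: eq_bigr => i _; rewrite efg. Qed.

Lemma act_poly_act (A : comNzRingType) L t (P : {poly A}) f u :
  act L (poly_act t P f) u = poly_act t P (act L f) u.
Proof.
by rewrite poly_actE -act_comm; apply: eq_act => z; apply: poly_actE.
Qed.

Lemma poly_act_comm (A : comNzRingType) s t (P Q : {poly A}) f u :
  poly_act s P (poly_act t Q f) u = poly_act t Q (poly_act s P f) u.
Proof.
rewrite poly_actE act_poly_act; apply: eq_poly_act => z.
by rewrite -poly_actE.
Qed.

(* A recurrence with nonzero leading coefficient determines a bounded integer
   sequence forwards from finitely many possible states. *)
Lemma recurrence_periodic (C : numDomainType) (P : {poly C}) t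
    (e : int * int -> int) (B : int) :
  P != 0 -> (forall u, `|e u| <= B) ->
  (forall u, poly_act t P (fun z => (e z)%:~R) u = 0) ->
  exists2 N : nat, (0 < N)%N & forall u, e (u + scale N%:Z t) = e u.
Proof.
move=> P0 bB HP.
have [d ed] : exists d, size P = d.+1.
  by exists (size P).-1; rewrite prednK // size_poly_gt0.
have lead0 : P`_d != 0 by move: P0; rewrite -lead_coef_eq0 lead_coefE ed.
have step u u' : (forall k, (k < d)%N -> e (u + scale k%:Z t) = e (u' + scale k%:Z t)) ->
    e (u + scale d%:Z t) = e (u' + scale d%:Z t).
  move=> H; have := HP u; rewrite -(HP u') /poly_act /coef_fold ed !big_ord_recr /=.
  under eq_bigr => i _ do rewrite H //.
  by move/addrI/(mulfI lead0)/eqP; rewrite eqr_int => /eqP.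
have forward u u' : (forall k, (k < d)%N -> e (u + scale k%:Z t) = e (u' + scale k%:Z t)) ->
    forall k : nat, e (u + scale k%:Z t) = e (u' + scale k%:Z t).
  move=> H; elim/ltn_ind => k IH; case: (ltnP k d) => [|le]; first exact: H.
  have E z : z + scale k%:Z t = z + scale (k - d)%N%:Z t + scale d%:Z t.
    by rewrite -addrA -scaleD -PoszD subnK.
  rewrite !E; apply: step => l ltl.
  by rewrite -!addrA -!scaleD -PoszD; apply: IH; lia.
pose b := absz B.
(* A state is a block of [d] consecutive values, shifted by [b] to become natural numbers at most
   [b + b]. *)
pose state u := [ffun k : 'I_d =>
  inord (absz (e (u + scale k%:Z t) + b%:Z)%R) : 'I_(b + b).+1].
pose M := #|{: {ffun 'I_d -> 'I_(b + b).+1}}|.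
(* The repetition length [j - i] depends on [u] but is at most [M], so it divides the uniform
   period. States are taken from [M] steps before [u] because determinism only runs forwards. *)
exists M`!; first exact: fact_gt0.
move=> u.
have [i [j [ltij lej /ffunP eij]]] :=
  pigeonhole_nat (fun i => state (u + scale (i%:Z - M%:Z) t)).
have /forward H : forall k, (k < d)%N ->
    e (u + scale (i%:Z - M%:Z) t + scale k%:Z t) =
    e (u + scale (j%:Z - M%:Z) t + scale k%:Z t).
  move=> k ltk; have := eij (Ordinal ltk); rewrite !ffunE /=.
  move: (bB (u + scale (i%:Z - M%:Z) t + scale k%:Z t)).
  move: (bB (u + scale (j%:Z - M%:Z) t + scale k%:Z t)).
  move: (e _) (e _) => x y by1 by2 /(congr1 val) /=.
  by rewrite !inordK; rewrite /b; lia.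
have leM : (j <= M)%N by [].
have Hr (k : nat) : e (u + scale (i%:Z - M%:Z) t + scale k%:Z t) =
    e (u + scale (i%:Z - M%:Z) t + scale (k + (j - i))%N%:Z t).
  rewrite H -!addrA -!scaleD; congr (e (_ + scale _ _)); lia.
have Hm m (k : nat) : e (u + scale (i%:Z - M%:Z) t + scale k%:Z t) =
    e (u + scale (i%:Z - M%:Z) t + scale (k + m * (j - i))%N%:Z t).
  elim: m k => [|m IH] k; first by rewrite addn0.
  by rewrite Hr IH; congr (e (_ + scale _ _)); lia.
have /dvdnP[m em] : (j - i %| M`!)%N by apply: dvdn_fact; lia.
have := Hm m (M - i)%N; rewrite -!addrA -!scaleD -em => E.
rewrite -[in RHS](addr0 u) -(scale0 t).
have -> : 0 = i%:Z - M%:Z + (M - i)%N%:Z by lia.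
by rewrite E; congr (e (_ + scale _ _)); lia.
Qed.

Definition det (v w : int * int) : int := v.1 * w.2 - v.2 * w.1.

Lemma det1_basis (w t u : int * int) : det w t = 1 ->
  u = scale (det u t) w + scale (det w u) t.
Proof.
move=> d1; apply: injective_projections => /=.
  by rewrite -[LHS]mul1r -d1 /det; ring.
by rewrite -[LHS]mul1r -d1 /det; ring.
Qed.

(* The image of the Laurent polynomial with terms [G] under X^w := z, X^t := X,
   multiplied by X^K. *)
Definition eval_direction (C : fieldType) (G : seq (C * (int * int)))
    (w t : int * int) (K : int) (z : C) : {poly C} :=
  \sum_(x <- G) (x.1 * z ^ det x.2 t) *: 'X^(absz (det w x.2 + K)%R).

Section Eliminate.

Variables (C : fieldType) (G : seq (C * (int * int))) (w t : int * int) (K : int).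
Hypothesis wt : det w t = 1.
Hypothesis KG : forall x, x \in G -> 0 <= det w x.2 + K.
Hypothesis evG : forall z, z != 0 -> eval_direction G w t K z != 0.

Lemma eigen_scale (e : int * int -> C) z : z != 0 ->
  (forall u, e (u + w) = z * e u) -> forall k u, e (u + scale k w) = z ^ k * e u.
Proof.
move=> z0 ez k u; elim: k u => [|k IH|k IH] u.
- by rewrite scale0 addr0 expr0z mul1r.
- by rewrite intS scaleD scale1 addrA IH ez mulrA -exprSzr.
- apply: (mulfI z0); rewrite -ez -addrA -{2}(scale1 w) -scaleD.
  have -> : - k.+1%:Z + 1 = - k%:Z by lia.
  have -> : - k.+1%:Z = -1 - k%:Z by lia.
  by rewrite IH expfzDr // exprN1 -mulrA mulVKf.
Qed.

(** Induction on the roots. After all other factors have acted, shifting by [w] multiplies by [z],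
    so [G] acts as [eval_direction] at [z], which must annihilate the result. Applying that
    polynomial to [e] therefore removes the root [z]. *)
Lemma eliminate_direction (rs : seq C) (e : int * int -> C) :
  all (fun z => z != 0) rs -> (forall u, act G e u = 0) ->
  (forall u, poly_act w (\prod_(z <- rs) ('X - z%:P)) e u = 0) ->
  exists2 P : {poly C}, P != 0 & forall u, poly_act t P e u = 0.
Proof.
elim: rs e => [|z rs IH] e /=.
  move=> _ _ H; exists 1 => [|u]; first exact: oner_neq0.
  by rewrite poly_act1 -[RHS](H u) big_nil poly_act1.
move=> /andP[z0 rs0] Ge; rewrite big_cons => He.
pose e1 := poly_act w (\prod_(z <- rs) ('X - z%:P)) e.
have e1z u : e1 (u + w) = z * e1 u.
  apply/eqP; rewrite -subr_eq0; have := He u.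
  rewrite poly_actM mulrC -/e1 -polyCN poly_actD -['X]mulr1 -[_%:P]mulr1.
  by rewrite poly_actXM poly_actCM !poly_act1 mulNr [z * _]mulrC => ->.
have Ge1 u : act G e1 u = 0.
  rewrite /e1 act_poly_act -[RHS](poly_act_eq0 w (\prod_(z <- rs) ('X - z%:P)) u).
  exact: eq_poly_act.
have Pe1 u : poly_act t (eval_direction G w t K z) e1 u = 0.
  rewrite /eval_direction poly_act_sum -[RHS](Ge1 (u + scale K t)) /act.
  rewrite big_seq [RHS]big_seq; apply: eq_bigr => x xG.
  rewrite poly_act_monomial gez0_abs ?KG // -mulrA -(eigen_scale z0 e1z).
  congr (_ * e1 _); rewrite {3}(det1_basis x.2 wt) scaleD.
  by rewrite -!addrA; congr (_ + _); rewrite [RHS]addrA [RHS]addrC.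
have [P P0 HP] : exists2 P : {poly C}, P != 0 &
    forall u, poly_act t P (poly_act t (eval_direction G w t K z) e) u = 0.
  apply: IH => // u.
    rewrite act_poly_act -[RHS](poly_act_eq0 t (eval_direction G w t K z) u).
    exact: eq_poly_act.
  by rewrite poly_act_comm; apply: Pe1.
exists (P * eval_direction G w t K z) => [|u]; first by rewrite mulf_neq0 ?evG.
by rewrite poly_actM HP.
Qed.

End Eliminate.

(** * Line polynomial factors *)

Section LaurentDivisibility.

Variable R : realType.
Implicit Types f g h : laurent R.

Lemma lmul_widen (d1 d2 : {fset int * int}) f g :
  msupp f `<=` d1 -> msupp g `<=` d2 ->
  lmul f g = \sum_(u <- d1) \sum_(v <- d2) << f@_u * g@_v *g u + v >>.
Proof.
move=> le1 le2; rewrite /lmul (big_fset_incl _ le1) => [|u _ nu]; last first.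
  by rewrite big1 // => v _; rewrite mcoeff_outdom // mul0r monalgU0.
apply: eq_bigr => u _; apply: big_fset_incl => // v _ nv.
by rewrite (mcoeff_outdom nv) mulr0 monalgU0.
Qed.

Lemma lmulDr f g h : lmul f (g + h) = lmul f g + lmul f h.
Proof.
rewrite (lmul_widen (fsubset_refl _) (msuppD_le g h)).
rewrite (lmul_widen (fsubset_refl _) (fsubsetUl (msupp g) (msupp h))).
rewrite (lmul_widen (fsubset_refl _) (fsubsetUr (msupp g) (msupp h))).
rewrite -big_split; apply: eq_bigr => u _; rewrite -big_split; apply: eq_bigr => v _.
by rewrite mcoeffD mulrDr monalgUD.
Qed.

Lemma lmulDl f g h : lmul (f + g) h = lmul f h + lmul g h.
Proof.
rewrite (lmul_widen (msuppD_le f g) (fsubset_refl _)).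
rewrite (lmul_widen (fsubsetUl (msupp f) (msupp g)) (fsubset_refl _)).
rewrite (lmul_widen (fsubsetUr (msupp f) (msupp g)) (fsubset_refl _)).
rewrite -big_split; apply: eq_bigr => u _; rewrite -big_split; apply: eq_bigr => v _.
by rewrite mcoeffD mulrDl monalgUD.
Qed.

Lemma lmulUU (x y : R[i]) (u v : int * int) :
  lmul << x *g u >> << y *g v >> = << x * y *g u + v >> :> laurent R.
Proof.
by rewrite (lmul_widen msuppU_le msuppU_le) !big_seq_fset1 !mcoeffUU.
Qed.

Lemma ldvdD f g h : ldvd f g -> ldvd f h -> ldvd f (g + h).
Proof. by move=> [a ->] [b ->]; exists (a + b); rewrite lmulDr. Qed.

Lemma lmul0r f : lmul f 0 = 0.
Proof. by apply: (addrI (lmul f 0)); rewrite -lmulDr !addr0. Qed.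

Lemma ldvd0 f : ldvd f 0.
Proof. by exists 0; rewrite lmul0r. Qed.

Lemma ldvdN f g : ldvd f g -> ldvd f (- g).
Proof.
move=> [a ->]; exists (- a); apply: (addrI (lmul f a)).
by rewrite -lmulDr !subrr lmul0r.
Qed.

Lemma ldvd_sum f (I : eqType) (r : seq I) (F : I -> laurent R) :
  (forall i, ldvd f (F i)) -> ldvd f (\sum_(i <- r) F i).
Proof.
by move=> H; elim/big_rec: _ => [|i g _]; [exact: ldvd0 | exact: ldvdD].
Qed.

Definition binomial_factor (w : int * int) (y : R[i]) : laurent R :=
  << w >> + << - y *g 0 >>.

Lemma binomial_factor_line w y : w != 0 -> y != 0 ->
  line_poly_in_direction w (binomial_factor w y).
Proof.
move=> w0 y0.
have supp : msupp (binomial_factor w y) = [fset w; 0].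
  rewrite msuppD !msuppU ?oner_eq0 ?oppr_eq0 (negbTE y0) //.
  by rewrite fdisjointX1 in_fset1 eq_sym.
split=> //; first by rewrite supp cardfs2 w0.
exists 0 => v; rewrite supp in_fset2 => /orP[/eqP ->|/eqP ->].
  by exists 1; rewrite /= !subr0 !mul1r.
by exists 0; rewrite /= !subr0 !mul0r.
Qed.

(** Modulo the binomial, [X^w] is congruent to the unit [y], so a power of either sign may be
    replaced. *)
Lemma ldvd_monomials w y c k u : y != 0 ->
  ldvd (binomial_factor w y)
    (<< c *g u + scale k w >> - << c * y ^ k *g u >>).
Proof.
move=> y0.
have step c' u' : ldvd (binomial_factor w y)
    (<< c' *g u' + w >> - << c' * y *g u' >>).
  exists << c' *g u' >>.
  by rewrite lmulDl !lmulUU mul1r add0r mulNr monalgUN addrC [w + _]addrC mulrC addrC.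
elim: k c u => [|k IH|k IH] c u.
- by rewrite scale0 addr0 expr0z mulr1 subrr; apply: ldvd0.
- have := ldvdD (step c (u + scale k%:Z w)) (IH (c * y) u).
  by rewrite addrA subrK -addrA intS scaleD scale1 [w + _]addrC exprSz mulrA.
- have := ldvdD (ldvdN (step (c / y) (u + scale (- k.+1%:Z) w))) (IH (c / y) u).
  rewrite mulfVK // opprB.
  have -> : u + scale (- k.+1%:Z) w + w = u + scale (- k%:Z) w.
    rewrite -addrA -{2}(scale1 w) -scaleD; congr (u + scale _ w); lia.
  rewrite addrA subrK (_ : c / y * _ = c * y ^ (- k.+1%:Z)) //.
  have -> : - k.+1%:Z = -1 - k%:Z by lia.
  by rewrite expfzDr // exprN1 mulrA.
Qed.

(** Exponents are negated because the exponents of [fpoly] are [- d], whereas the covering condition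
    reads the points [u + d]. *)
Definition terms g : seq (R[i] * (int * int)) := [seq (g@_u, - u) | u <- msupp g].

(** If the evaluation vanished, so would the remainder of [g] modulo [X^w - z^-1], and this binomial
    would divide [g]. The inverse comes from the negated exponents in [terms]. *)
Lemma eval_direction_neq0 g w t K z : det w t = 1 -> z != 0 ->
  (forall x, x \in terms g -> 0 <= det w x.2 + K) ->
  ~ ldvd (binomial_factor w z^-1) g -> eval_direction (terms g) w t K z != 0.
Proof.
move=> wt z0 HK ndv; apply/eqP => E; apply: ndv.
have y0 : z^-1 != 0 by rewrite invr_eq0.
(* Writing [u] in the basis [w, t] and replacing [X^w] by [z^-1] leaves this monomial in [X^t]. *)
pose rest u : laurent R := << g@_u * z^-1 ^ det u t *g scale (det w u) t >>.
have rest0 : \sum_(u <- msupp g) rest u = 0.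
  apply/malgP => x; rewrite raddf_sum /= mcoeff0.
  have t0 d d' : scale d t = scale d' t -> d = d'.
    move=> /(congr1 (det w)); rewrite /det /scale /=.
    have H a : w.1 * (a * t.2) - w.2 * (a * t.1) = a.
      by rewrite -[RHS]mulr1 -wt /det; ring.
    by rewrite !H.
  case: (boolP (has (fun u => scale (det w u) t == x) (msupp g))); last first.
    move=> /hasPn nx; rewrite big_seq big1 // => u /nx nu.
    by rewrite mcoeffU (negbTE nu).
  case/hasP => u0 u0g /eqP <-.
  have detN u : det w (- u) = - det w u by rewrite /det /=; ring.
  have detN2 u : det (- u) t = - det u t by rewrite /det /=; ring.
  have := congr1 (fun P : {poly _} => P`_(absz (- det w u0 + K)%R)) E.
  rewrite coef0 /eval_direction big_map coef_sum => E'.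
  rewrite -[RHS]E' big_seq [RHS]big_seq.
  have KP u : u \in msupp g -> 0 <= - det w u + K.
    by move=> ug; rewrite -detN; apply: (HK (g@_u, - u)); apply/mapP; exists u.
  apply: eq_bigr => u ug; rewrite coefZ coefXn mcoeffU /= detN detN2 -exprz_inv.
  rewrite mulr_natr; congr (_ *+ nat_of_bool _).
  have := KP _ ug; have := KP _ u0g => k0 k1.
  apply/eqP/eqP => [/t0 -> //|e]; congr (scale _ t); lia.
have E' : \sum_(u <- msupp g) (<< g@_u *g u >> - rest u) = g.
  by rewrite sumrB rest0 subr0 -monalgE.
rewrite -[X in ldvd _ X]E'; apply: ldvd_sum => u.
have := ldvd_monomials w g@_u (det u t) (scale (det w u) t) y0.
by rewrite (addrC (scale _ t)) -(det1_basis u wt).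
Qed.

End LaurentDivisibility.

(** * From annihilating differences to a period *)

Lemma diff_periodic (A : zmodType) (f : int * int -> A) v :
  (forall u, diff v f u = 0) <-> (forall u, f (u + v) = f u).
Proof.
by split=> H u; [apply/eqP; rewrite -subr_eq0; apply/eqP/H | rewrite /diff H subrr].
Qed.

(** Divide [w] by the gcd of its coordinates; Bezout coefficients supply [t]. *)
Lemma primitive_vector (w : int * int) : w != 0 -> exists (m : nat) w0 t,
  [/\ (0 < m)%N, w = scale m%:Z w0 & det w0 t = 1].
Proof.
move=> w0; have [x [y exy]] := Bezoutz w.1 w.2.
have [a ea] := dvdzP (dvdz_gcdl w.1 w.2).
have [b eb] := dvdzP (dvdz_gcdr w.1 w.2).
have g0 : gcdz w.1 w.2 != 0.
  rewrite gcdz_eq0; apply: contra w0 => /andP[/eqP h1 /eqP h2].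
  by case: (w) h1 h2 => c d /= -> ->.
exists (absz (gcdz w.1 w.2)), (a, b), (- y, x); split; first by rewrite absz_gt0.
  rewrite gez0_abs //; apply: injective_projections => /=.
    by rewrite {1}ea mulrC.
  by rewrite {1}eb mulrC.
apply: (mulIf g0); rewrite mul1r -[RHS]exy; move: ea eb; set G := gcdz _ _.
by move=> -> ->; rewrite /det /=; ring.
Qed.

(** If [w = q v], then [denq q] times [w] is [numq q] times [v], so the absolute numerator of [q]
    serves as [N]. *)
Lemma scale_periodic_parallel (e : int * int -> int) v w : w != 0 ->
  parallel v w -> (forall u, e (u + w) = e u) ->
  exists2 N : nat, (0 < N)%N & forall u, e (u + scale N%:Z v) = e u.
Proof.
move=> w0 [q /= [e1 e2]] per; rewrite !subr0 in e1 e2.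
have E : scale (denq q) w = scale (numq q) v.
  have H (x y : int) : x%:~R = q * y%:~R -> denq q * x = numq q * y.
    move=> h; apply: (@intr_inj rat); rewrite !rmorphM /= h mulrA [_%:~R * q]mulrC.
    by rewrite -{1}(divq_num_den q) divfK // intr_eq0 denq_neq0.
  by rewrite /scale (H _ _ e1) (H _ _ e2).
have n0 : numq q != 0.
  apply: contra w0; rewrite numq_eq0 => /eqP q0; move: e1 e2.
  rewrite q0 !mul0r => /eqP; rewrite intr_eq0 => /eqP h1 /eqP.
  by rewrite intr_eq0 => /eqP h2; case: (w) h1 h2 => a b /= -> ->.
exists (absz (numq q)); first by rewrite absz_gt0.
have per' k u : e (u + scale (k * numq q) v) = e u.
  by rewrite -scaleA -E scaleA (periodic_scale per).
by move=> u; rewrite abszE normrEsg per'.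
Qed.

Lemma diffs_bounded ws (e : int * int -> int) (B : int) :
  (forall u, `|e u| <= B) -> exists B' : int, forall u, `|diffs ws e u| <= B'.
Proof.
elim: ws e B => [|w ws IH] e B bB; first by exists B.
apply: (IH (diff w e) (B + B)) => u; rewrite /diff.
by apply: le_trans (ler_normB _ _) _; apply: lerD.
Qed.

Lemma act_diffs (A : nzRingType) (L : seq (A * (int * int))) ws (e : int * int -> int) :
  (forall u, act L (fun z => (e z)%:~R) u = 0) ->
  forall u, act L (fun z => (diffs ws e z)%:~R) u = 0.
Proof.
elim: ws e => //= w ws IH e H; apply: IH => u.
rewrite -[RHS]subr0 -[X in _ = X - _](H (u + w)) -[X in _ = _ - X](H u) -sumrB.
by apply: eq_bigr => x _; rewrite /diff rmorphB mulrBr addrAC.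
Qed.

Lemma poly_act_XnB1 (A : comNzRingType) v n (e : int * int -> int) u :
  poly_act v ('X^n - 1) (fun z => (e z)%:~R : A) u = (diff (scale n%:Z v) e u)%:~R.
Proof.
rewrite poly_actD -['X^n]scale1r poly_act_monomial mul1r -polyCN -[_%:P]mulr1.
by rewrite poly_actCM poly_act1 mulN1r /diff rmorphB.
Qed.

Lemma poly_act_prod_XnB1 (A : comNzRingType) v ns (e : int * int -> int) u :
  poly_act v (\prod_(n <- ns) ('X^n - 1)) (fun z => (e z)%:~R : A) u =
  (diffs [seq scale n%:Z v | n <- ns] e u)%:~R.
Proof.
elim: ns e u => [|n ns IH] e u /=; first by rewrite big_nil poly_act1.
rewrite big_cons mulrC poly_actM -IH; apply: eq_poly_act => z.
exact: poly_act_XnB1.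
Qed.

(** Differences along multiples of one vector [v] multiply to a single nonzero polynomial in [X^v],
    that is, to a recurrence for a bounded sequence. *)
Lemma diffs_multiples_periodic (e : int * int -> int) (B : int) v (ns : seq nat) :
  (forall u, `|e u| <= B) -> all (leq 1) ns ->
  (forall u, diffs [seq scale n%:Z v | n <- ns] e u = 0) ->
  exists2 N : nat, (0 < N)%N & forall u, e (u + scale N%:Z v) = e u.
Proof.
move=> bB pos H; pose P : {poly int} := \prod_(n <- ns) ('X^n - 1).
have P0 : P != 0.
  rewrite /P; elim: ns pos {H P} => [|n ns IH] /=; first by rewrite big_nil oner_neq0.
  move=> /andP[n0 pos]; rewrite big_cons mulf_neq0 ?IH //.
  by rewrite -polyC1 monic_neq0 // monicXnsubC.
apply: (recurrence_periodic P0 bB) => u.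
by rewrite /P poly_act_prod_XnB1 H.
Qed.

Section OneDirection.

Variables (R : realType) (g : laurent R) (v : int * int).
Hypothesis line : forall f w, line_poly_in_direction w f -> ldvd f g -> parallel v w.

Let killed (e : int * int -> int) :=
  forall u, act (terms g) (fun z => (e z)%:~R) u = 0.

Lemma period_transfer (e : int * int -> int) (B : int) w : w != 0 ->
  (forall u, `|e u| <= B) -> killed e -> (forall u, e (u + w) = e u) ->
  exists2 N : nat, (0 < N)%N & forall u, e (u + scale N%:Z v) = e u.
Proof.
move=> w0 bB ke per.
have [par|npar] := boolp.pselect (parallel v w).
  exact: scale_periodic_parallel par per.
have [m [w1 [t [m0 ew wt]]]] := primitive_vector w0.
have w10 : w1 != 0.
  by apply: contra w0 => /eqP h; rewrite ew h /scale /= !mulr0.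
have nparw1 : ~ parallel v w1.
  move=> [q /= [e1 e2]]; apply: npar; exists (m%:R * q) => /=; rewrite !subr0 in e1 e2 *.
  by rewrite ew /= !rmorphM /= e1 e2 !mulrA.
pose K : int := \sum_(x <- terms g) `|det w1 x.2|.
have HK x : x \in terms g -> 0 <= det w1 x.2 + K.
  move=> xg; have : `|det w1 x.2| <= K.
    by rewrite /K (big_rem x) //= lerDl sumr_ge0.
  by lia.
have evg z : z != 0 -> eval_direction (terms g) w1 t K z != 0.
  move=> z0; apply: eval_direction_neq0 => // dv; apply: nparw1.
  by apply: line dv; apply: binomial_factor_line; rewrite ?invr_eq0.
(* The period [w = m w1] means that [X^m - 1], with [X] shifting by [w1], annihilates [e]; over
   [R[i]] it splits into linear factors. *)
have [rs] := closed_field_poly_normal ('X^m - 1 : {poly R[i]}).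
rewrite -polyC1 (monicP _) ?monicXnsubC // scale1r => Ers.
have rs0 : all (fun z => z != 0) rs.
  apply/allP => z zrs; apply/eqP => ez; have := root_prod_XsubC rs 0.
  rewrite -{2}ez zrs -Ers rootE !hornerE expr0n; case: (m) m0 => //= _ _.
  by rewrite sub0r oppr_eq0 oner_eq0.
have [|P P0 HP] := eliminate_direction wt HK evg rs0 ke.
  by move=> u; rewrite -Ers polyC1 poly_act_XnB1 -ew /diff per subrr.
have [N N0 HN] := recurrence_periodic P0 bB HP.
(* In the basis [w1, t], the vector [m N v] is a combination of the periods [w = m w1] and [N t]. *)
exists (m * N)%N => [|u]; first by rewrite muln_gt0 m0.
have -> : scale (m * N)%N v =
    scale (det v t * N%:Z) w + scale (det w1 v * m%:Z) (scale N%:Z t).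
  rewrite {1}(det1_basis v wt) ew !scaleA PoszM; apply: injective_projections => /=; ring.
by rewrite addrA (periodic_scale HN) (periodic_scale per).
Qed.

(** Applying the differences other than [w] gives a bounded [w]-periodic configuration annihilated
    by [g], so [period_transfer] replaces [w] by a multiple of [v]. That difference is then applied
    to [e] itself before recursing. *)
Lemma diffs_to_multiples ws (e : int * int -> int) (B : int) :
  all (fun w => w != 0) ws -> (forall u, `|e u| <= B) -> killed e ->
  (forall u, diffs ws e u = 0) ->
  exists2 ns : seq nat, all (leq 1) ns &
    forall u, diffs [seq scale n%:Z v | n <- ns] e u = 0.
Proof.
elim: ws e B => [|w ws IH] e B /=; first by move=> _ _ _ H; exists [::].
move=> /andP[w0 ws0] bB ke H; have [B1 bB1] := diffs_bounded ws bB.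
have [|N N0 HN] := period_transfer w0 bB1 (act_diffs ws ke).
  by apply/diff_periodic => u; rewrite -diffs_diff.
have [||u|ns pos Hns] := IH (diff (scale N%:Z v) e) (B + B) ws0.
- by move=> u; apply: le_trans (ler_normB _ _) _; apply: lerD.
- exact: (act_diffs [:: scale N%:Z v] ke).
- by rewrite diffs_diff; move: u; apply/diff_periodic.
- by exists (N :: ns) => //=; rewrite N0.
Qed.

End OneDirection.

Lemma act_covering_poly (R : realType) D b a (f : int * int -> R[i]) u :
  act (terms (covering_poly R D b a)) f u =
  \sum_(d <- D) f (u + d) - (b%:Z - a%:Z)%:~R * f u.
Proof.
rewrite /act big_map; pose h x := f (u - x).
rewrite -[LHS]/(mmap idfun h (covering_poly R D b a)) raddfB /= raddf_sum /=.
rewrite mmapU /h subr0; congr (_ - _).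
by apply: eq_bigr => d _; rewrite mmapU /= mul1r opprK.
Qed.

(** Line factors are taken over [R[i]], but dilation reduces coefficients modulo primes and needs
    integers. *)
Lemma covering_poly_int (R : realType) D b a : exists z : int * int -> int,
  forall u, (covering_poly R D b a)@_u = (z u)%:~R.
Proof.
exists (fun u => \sum_(d <- D) (- d == u)%:Z - (b%:Z - a%:Z) *+ (0 == u)) => u.
rewrite /covering_poly /fpoly mcoeffB raddf_sum [RHS]rmorphB [in RHS]rmorph_sum /=.
congr (_ - _); last by rewrite mcoeffU rmorphMn.
by apply: eq_bigr => d _; rewrite mcoeffU; case: (_ == _).
Qed.

Lemma diffs_mulr ws (k : int) (e : int * int -> int) u :
  diffs ws (fun z => k * e z) u = k * diffs ws e u.
Proof.
elim: ws e u => //= w ws IH e u; rewrite -IH; apply: eq_diffs => z.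
by rewrite /diff mulrBr.
Qed.

(** In the relations dilated by [1 + q k], the term of [x] moves by [- q x] as [k] grows by one, so
    [diffs_family] applies. Keeping only [u0] leaves differences along [q (x - u0)], nonzero for [x]
    other than [u0]. *)
Lemma diffs_annihilator (S : seq (int * int)) (z : int * int -> int) e (B : int) u0 :
  uniq S -> u0 \in S -> z u0 != 0 -> (forall u, `|e u| <= B) ->
  (forall u, act [seq (z x, - x) | x <- S] e u = 0) ->
  exists2 ws, all (fun w => w != 0) ws & forall u, diffs ws e u = 0.
Proof.
move=> uS u0S z0 bB kS; have [q q0 Hq] := dilation bB kS.
pose fs := [seq (fun y => z x * e (y - x), scale q%:Z (- x)) | x <- rem u0 S].
pose f0 y := z u0 * e (y - u0).
have H u : diffs [seq scale q%:Z (- u0) - x.2 | x <- fs] f0 u = 0.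
  apply: diffs_family => k y; rewrite -[RHS](Hq k y) /act !big_map /= (big_rem u0 u0S) /=.
  have E x : y + scale k%:Z (scale q%:Z (- x)) - x = y + scale (1 + q%:Z * k%:Z) (- x).
    rewrite scaleA scaleD scale1 mulrC -addrA; congr (_ + _); exact: addrC.
  by rewrite /f0 E; congr (_ + _); apply: eq_bigr => x _; rewrite E.
exists [seq scale q%:Z (- u0) - x.2 | x <- fs].
  rewrite -map_comp all_map; apply/allP => x; rewrite mem_rem_uniq // !inE => /andP[nx _] /=.
  rewrite subr_eq0; apply: contra nx => /eqP [] /mulfI h1 /mulfI h2.
  have q0' : q%:Z != 0 by rewrite eqz_nat -lt0n.
  have /oppr_inj := h1 q0'; have /oppr_inj := h2 q0'.
  by case: (x) (u0) => a b [c d] /= -> ->.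
move=> u; apply: (mulfI z0); rewrite mulr0 -[RHS](H (u + u0)).
rewrite /f0 (diffs_mulr _ _ (fun y => e (y - u0))); congr (_ * _).
by rewrite (diffs_shift _ e (- u0)) addrK.
Qed.

Lemma covering_periodic (R : realType) D b a c :
  line_factors_in_at_most_one_direction (covering_poly R D b a) ->
  covering D b a c -> exists2 p, p != 0 & forall u, c (u + p) = c u.
Proof.
move=> [v v0 line] /(covering_sumE _ _ _ (fset_uniq D) (fun _ => erefl)) cov.
set g := covering_poly R D b a in line *.
pose cz u : int := (c u : nat)%:Z.
have bcz u : `|cz u| <= 1 by rewrite /cz; case: (c u).
have covz u : \sum_(d <- D) cz (u + d) - (b%:Z - a%:Z) * cz u = a%:Z.
  rewrite /cz -(big_morph Posz PoszD (erefl 0%:Z)) cov.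
  by case: (c u); rewrite ?mulr1 ?mulr0; lia.
(* The polynomial sends [cz] to the constant [a], which differencing removes. Differencing along [v]
   itself costs only one more factor in the direction [v]. *)
pose e := diff v cz.
have be u : `|e u| <= 2 by have := bcz u; have := bcz (u + v); rewrite /e /diff; lia.
have ke u : act (terms g) (fun z => (e z)%:~R) u = 0.
  rewrite act_covering_poly -rmorph_sum -rmorphM -rmorphB /=.
  rewrite -[RHS]/((0 : int)%:~R); congr (_%:~R).
  have -> : \sum_(d <- D) e (u + d) = \sum_(d <- D) cz (u + v + d) - \sum_(d <- D) cz (u + d).
    by rewrite -sumrB; apply: eq_bigr => d _; rewrite /e /diff addrAC.
  rewrite -[RHS](subrr a%:Z) -[X in _ = X - _](covz (u + v)) -[X in _ = _ - X](covz u).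
  by rewrite /e /diff; ring.
have [z Hz] := covering_poly_int R D b a.
have kz u : act [seq (z x, - x) | x <- msupp g] e u = 0.
  apply: (@intr_inj R[i]); rewrite -[RHS](ke u) /act !big_map rmorph_sum /=.
  by apply: eq_bigr => x _; rewrite rmorphM /= -Hz.
(* If [g] were zero, binomials in every direction would divide it, making both unit vectors
   multiples of [v]. *)
have [u0 u0g] : exists u0, u0 \in msupp g.
  case: (fset_0Vmem (msupp g)) => [S0|[u0 u0g]]; last by exists u0.
  have g0 : g = 0 by rewrite [LHS]monalgE S0 big_seq_fset0.
  have par w : w != 0 -> parallel v w.
    move=> w0; apply: (line (binomial_factor w 1)).
      by apply: binomial_factor_line => //; apply: oner_neq0.
    by rewrite g0; apply: ldvd0.
  have [x /= [x1 x2]] := par (1, 0) isT; have [y /= [y1 y2]] := par (0, 1) isT.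
  rewrite !subr0 in x1 x2 y1 y2.
  have : x * v.2%:~R == 0 by rewrite -x2.
  rewrite mulf_eq0 => /orP[/eqP h|/eqP h].
    by move: x1; rewrite h mul0r => /eqP; rewrite intr_eq0.
  by move: y2; rewrite h mulr0 => /eqP; rewrite intr_eq0.
have zu0 : z u0 != 0.
  by rewrite -(intr_eq0 R[i]) -Hz mcoeff_neq0.
have [ws ws0 Hws] := diffs_annihilator (fset_uniq _) u0g zu0 be kz.
have [ns pos Hns] := diffs_to_multiples line ws0 be ke Hws.
(* The leading [1] stands for the difference along [v] that produced [e] from [cz]. *)
have [N N0 HN] : exists2 N : nat, (0 < N)%N & forall u, cz (u + scale N%:Z v) = cz u.
  apply: (@diffs_multiples_periodic cz 1 v (1%N :: ns)) => //= u.
  by rewrite scale1 Hns.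
exists (scale N%:Z v) => [|u].
  apply: contra v0 => /eqP [/eqP h1 /eqP h2]; move: h1 h2.
  by rewrite !mulf_eq0 !eqz_nat !(gtn_eqF N0) /=; case: (v) => x y /= /eqP -> /eqP ->.
by have := HN u; rewrite /cz; case: (c _); case: (c _).
Qed.

Theorem theorem26 :
  exists p : recfun,
    forall (R : realType) (D : {fset int * int}) (b a : nat)
           (s : seq (int * int)),
      line_factors_in_at_most_one_direction (covering_poly R D b a) ->
      uniq s -> s =i D ->
      ((exists c, covering D b a c) -> eval p [:: code_points s; b; a] 1)
      /\ (~ (exists c, covering D b a c) -> eval p [:: code_points s; b; a] 0).
Proof.
have [p Hp] := decision_by_search; exists p => R D b a s line us sD.
apply: (Hp D b a s us sD) => -[c cov].
have [v v0 per] := covering_periodic line cov.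
exact: (torus_periodic_covering v0 cov per).
Qed.
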